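(* Let $\Bbbk$ be a commutative unital ring, $A$ a $\Bbbk$-superalgebra free of finite rank over $\Bbbk$ (with a homogeneous basis), $d\in\mathbb Z_{\ge0}$, $n\in\mathbb Z_{>0}$, and $V=A^{\oplus n}$. The natural embedding $$S^A(n,d)\hookrightarrow M_n(A)^{\otimes d}\;\cong\;\mathrm{End}_{A^{\otimes d}}(V^{\otimes d})$$ defines an isomorphism of superalgebras $S^A(n,d)\cong\mathrm{End}_{W_d^A}(V^{\otimes d})$.
   Context: $\mathbb Z_2=\{\bar0,\bar1\}$; $\bar v$ is the parity of a homogeneous element $v$; formulas with parities are for homogeneous elements, extended linearly. Superalgebras are associative, unital, $\mathbb Z_2$-graded. Put $[u_1,\dots,u_d;w_1,\dots,w_d]=\sum_{1\le a<c\le d}\bar u_c\bar w_a$. A tensor power of a superalgebra is a superalgebra via $(x_1\otimes\cdots\otimes x_d)(y_1\otimes\cdots\otimes y_d)=(-1)^{[x_1,\dots,x_d;y_1,\dots,y_d]}x_1y_1\otimes\cdots\otimes x_dy_d$. The symmetric group $\mathfrak S_d$ acts on the right on the $d$th tensor power of a superspace by $(v_1\otimes\cdots\otimes v_d)^g=(-1)^{m}v_{g1}\otimes\cdots\otimes v_{gd}$, $m=\sum_{1\le a<c\le d,\ g^{-1}a>g^{-1}c}\bar v_a\bar v_c$. $M_n(A)$ is a superalgebra with parity determined by entries; $S^A(n,d):=(M_n(A)^{\otimes d})^{\mathfrak S_d}$, a subsuperalgebra of $M_n(A)^{\otimes d}$. The super wreath product $W_d^A=A^{\otimes d}\rtimes\Bbbk\mathfrak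 S_d$ is $A^{\otimes d}\otimes\Bbbk\mathfrak S_d$ as a module ($\Bbbk\mathfrak S_d$ of parity $\bar0$), contains $A^{\otimes d}$ and $\Bbbk\mathfrak S_d$ as subsuperalgebras, and $g^{-1}xg=x^g$ for $g\in\mathfrak S_d$, $x\in A^{\otimes d}$. $V=A^{\oplus n}$ is viewed as column vectors, a left $M_n(A)$- and right $A$-supermodule, so $M_n(A)\cong\mathrm{End}_A(V)$ via left multiplication. $M_n(A)^{\otimes d}$ acts on $V^{\otimes d}$ by $(\xi_1\otimes\cdots\otimes\xi_d)(v_1\otimes\cdots\otimes v_d)=(-1)^{[\xi_1,\dots,\xi_d;v_1,\dots,v_d]}\xi_1v_1\otimes\cdots\otimes\xi_dv_d$, which gives the displayed isomorphism $M_n(A)^{\otimes d}\cong\mathrm{End}_{A^{\otimes d}}(V^{\otimes d})$; here $A^{\otimes d}$ acts from the right by $(v_1\otimes\cdots\otimes v_d)(a_1\otimes\cdots\otimes a_d)=(-1)^{[v_1,\dots,v_d;a_1,\dots,a_d]}v_1a_1\otimes\cdots\otimes v_da_d$. Together with $vg:=v^g$ for $g\in\mathfrak S_d$, this makes $V^{\otimes d}$ a right $W_d^A$-supermodule. *)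

(* Defs.v *)
From HB Require Import structures.
From mathcomp Require Import all_boot all_order all_algebra all_fingroup.
From mathcomp Require Import generic_quotient boolp.

Set Implicit Arguments.
Unset Strict Implicit.
Unset Printing Implicit Defensive.

Import GRing.Theory.
Local Open Scope ring_scope.
Local Open Scope quotient_scope.

(* A grading V = V_0 (+) V_1 is given by its two projections
   hcomp false, hcomp true. Superalgebras are not built on [algType], which
   would exclude the zero algebra. *)
HB.mixin Record Lmodule_isSuperspace (k : comPzRingType) V of GRing.Lmodule k V := {
  hcomp : bool -> V -> V;
  hcomp_linear : forall e, linear (hcomp e);
  hcomp_hcomp : forall e f v, hcomp e (hcomp f v) = if e == f then hcomp f v else 0;
  hcomp_sum : forall v, hcomp false v + hcomp true v = v }.

#[short(type="superspaceType")]
HB.structure Definition Superspace (k : comPzRingType) :=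
  { V of GRing.Lmodule k V & Lmodule_isSuperspace k V }.

Definition homog (k : comPzRingType) (V : superspaceType k) (e : bool) (v : V) :=
  hcomp e v = v.

HB.mixin Record Superspace_isSuperalgebra (k : comPzRingType) A of Superspace k A := {
  smul : A -> A -> A;
  sone : A;
  smulA : associative smul;
  smul1x : left_id sone smul;
  smulx1 : right_id sone smul;
  smul_linearl : forall y, linear (smul^~ y);
  smul_linearr : forall x, linear (smul x);
  homog_smul : forall e f (x y : A),
    homog e x -> homog f y -> homog (e (+) f) (smul x y) }.

#[short(type="superalgType")]
HB.structure Definition Superalgebra (k : comPzRingType) :=
  { A of Superspace k A & Superspace_isSuperalgebra k A }.

Notation "x ** y" := (smul x y) (at level 40, left associativity) : ring_scope.

Definition superalg_iso (k : comPzRingType) (B C : superalgType k) (f : B -> C) :=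
  [/\ linear f, {morph f : x y / x ** y}, f sone = sone,
      (forall e x, homog e x -> homog e (f x)) & bijective f].

Definition homog_basis (k : comPzRingType) (V : superspaceType k)
    (I : finType) (b : I -> V) :=
  (forall i, exists e, homog e (b i)) /\
  (forall v, exists! c : {ffun I -> k}, v = \sum_i c i *: b i).

Section SuperspaceTheory.
Variables (k : comPzRingType) (V : superspaceType k).
Implicit Types u v : V.

Lemma hcomp0 e : hcomp e (0 : V) = 0.
Proof.
by have := hcomp_linear e (-1) (0 : V) 0; rewrite scaler0 addr0 scaleN1r addNr.
Qed.

Lemma hcompD e u v : hcomp e (u + v) = hcomp e u + hcomp e v.
Proof. by have := hcomp_linear e 1 u v; rewrite !scale1r. Qed.

Lemma hcompZ e (c : k) u : hcomp e (c *: u) = c *: hcomp e u.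
Proof. by have := hcomp_linear e c u 0; rewrite !addr0 hcomp0 addr0. Qed.

Lemma homog_hcomp e u : homog e (hcomp e u).
Proof. by rewrite /homog hcomp_hcomp eqxx. Qed.

Lemma homog_neq e f u : homog e u -> f != e -> hcomp f u = 0.
Proof. by move=> <- /negPf h; rewrite hcomp_hcomp h. Qed.

Lemma homogE e f u : homog e u -> hcomp f u = if f == e then u else 0.
Proof. by move=> h; case: eqVneq => [->|/(homog_neq h)]. Qed.

Lemma homogD e u v : homog e u -> homog e v -> homog e (u + v).
Proof. by rewrite /homog hcompD => -> ->. Qed.

Lemma homogZ e (c : k) u : homog e u -> homog e (c *: u).
Proof. by rewrite /homog hcompZ => ->. Qed.

Lemma homog0 e : homog e (0 : V).
Proof. exact: hcomp0. Qed.

Lemma homog_sum e (J : Type) (r : seq J) (P : pred J) (F : J -> V) :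
  (forall j, P j -> homog e (F j)) -> homog e (\sum_(j <- r | P j) F j).
Proof. by move=> h; elim/big_rec: _ => [|j x /h]; [exact: homog0|exact: homogD]. Qed.

Lemma hcomp_sumE u : \sum_(e : bool) hcomp e u = u.
Proof. by rewrite big_bool /= addrC hcomp_sum. Qed.

End SuperspaceTheory.

Section LinearLemmas.
Variables (k : comPzRingType) (V W : lmodType k) (f : V -> W).
Hypothesis fl : linear f.

Lemma linfun0 : f 0 = 0.
Proof. by have := fl (-1) 0 0; rewrite scaler0 addr0 scaleN1r addNr. Qed.

Lemma linfunD u v : f (u + v) = f u + f v.
Proof. by have := fl 1 u v; rewrite !scale1r. Qed.

Lemma linfunZ c u : f (c *: u) = c *: f u.
Proof. by have := fl c u 0; rewrite !addr0 linfun0 addr0. Qed.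

Lemma linfun_sum (J : Type) (r : seq J) (P : pred J) (F : J -> V) :
  f (\sum_(j <- r | P j) F j) = \sum_(j <- r | P j) f (F j).
Proof. exact: (big_morph f linfunD linfun0). Qed.

End LinearLemmas.

Section TensorPower.
Variables (k : comPzRingType) (d : nat) (V : lmodType k).

Definition tset (t : {ffun 'I_d -> V}) (i : 'I_d) (x : V) : {ffun 'I_d -> V} :=
  [ffun j => if j == i then x else t j].

Definition multilinear (W : lmodType k) (f : {ffun 'I_d -> V} -> W) :=
  forall t i, linear (fun x => f (tset t i x)).

Definition fsum := seq (k * {ffun 'I_d -> V}).

Definition feval (W : lmodType k) (f : {ffun 'I_d -> V} -> W) (s : fsum) : W :=
  \sum_(p <- s) p.1 *: f p.2.

(* The tensor power is the free module on V^d modulo all the relations that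
   hold under every multilinear map; see [tlift_tens], [tlift_uniq] for its
   universal property. *)
Definition teq (s s' : fsum) : bool :=
  `[< forall (W : lmodType k) (f : {ffun 'I_d -> V} -> W),
        multilinear f -> feval f s = feval f s' >].

Lemma teq_refl : reflexive teq.
Proof. by move=> s; apply/asboolP. Qed.

Lemma teq_sym : symmetric teq.
Proof.
by move=> s s'; apply/asboolP/asboolP => h W f fm; rewrite h.
Qed.

Lemma teq_trans : transitive teq.
Proof.
by move=> s s' s'' /asboolP h /asboolP h'; apply/asboolP => W f fm; rewrite h ?h'.
Qed.

Canonical teq_equiv := EquivRel teq teq_refl teq_sym teq_trans.

Definition tpow := {eq_quot teq}.
HB.instance Definition _ := Choice.on tpow.
HB.instance Definition _ := Quotient.on tpow.

Definition tlift (W : lmodType k) (f : {ffun 'I_d -> V} -> W) (x : tpow) : W :=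
  feval f (repr x).

Definition tens (t : {ffun 'I_d -> V}) : tpow := \pi_tpow [:: (1, t)].

Lemma tlift_pi (W : lmodType k) (f : {ffun 'I_d -> V} -> W) s :
  multilinear f -> tlift f (\pi_tpow s) = feval f s.
Proof.
move=> fm; rewrite /tlift.
have /eqmodP/asboolP h : \pi_tpow (repr (\pi_tpow s)) = \pi_tpow s by rewrite reprK.
exact: h.
Qed.

Lemma tpow_ext (x y : tpow) :
  (forall (W : lmodType k) (f : {ffun 'I_d -> V} -> W),
     multilinear f -> tlift f x = tlift f y) -> x = y.
Proof. by move=> h; rewrite -[x]reprK -[y]reprK; apply/eqmodP/asboolP. Qed.

Definition tadd (x y : tpow) : tpow := \pi_tpow (repr x ++ repr y).
Definition tzero : tpow := \pi_tpow [::].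
Definition tscale (c : k) (x : tpow) : tpow :=
  \pi_tpow [seq (c * p.1, p.2) | p <- repr x].
Definition topp := tscale (-1).

Section Lift.
Variables (W : lmodType k) (f : {ffun 'I_d -> V} -> W) (fm : multilinear f).

Lemma tlift_add x y : tlift f (tadd x y) = tlift f x + tlift f y.
Proof. by rewrite tlift_pi // /feval big_cat. Qed.

Lemma tlift_zero : tlift f tzero = 0.
Proof. by rewrite tlift_pi // /feval big_nil. Qed.

Lemma tlift_scale c x : tlift f (tscale c x) = c *: tlift f x.
Proof.
rewrite tlift_pi // /feval big_map scaler_sumr.
by apply: eq_bigr => p _; rewrite scalerA.
Qed.

Lemma tlift_opp x : tlift f (topp x) = - tlift f x.
Proof. by rewrite tlift_scale scaleN1r. Qed.

Lemma tlift_tens t : tlift f (tens t) = f t.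
Proof. by rewrite tlift_pi // /feval big_seq1 scale1r. Qed.

End Lift.

Let liftE := (tlift_add, tlift_zero, tlift_opp, tlift_scale).

Lemma taddA : associative tadd.
Proof. by move=> x y z; apply: tpow_ext => W f fm; rewrite !liftE // addrA. Qed.
Lemma taddC : commutative tadd.
Proof. by move=> x y; apply: tpow_ext => W f fm; rewrite !liftE // addrC. Qed.
Lemma tadd0 : left_id tzero tadd.
Proof. by move=> x; apply: tpow_ext => W f fm; rewrite !liftE // add0r. Qed.
Lemma taddN : left_inverse tzero topp tadd.
Proof. by move=> x; apply: tpow_ext => W f fm; rewrite !liftE // addNr. Qed.

HB.instance Definition _ := GRing.isZmodule.Build tpow taddA taddC tadd0 taddN.

Lemma tscaleA a b x : tscale a (tscale b x) = tscale (a * b) x.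
Proof. by apply: tpow_ext => W f fm; rewrite !liftE // scalerA. Qed.
Lemma tscale1 : left_id 1 tscale.
Proof. by move=> x; apply: tpow_ext => W f fm; rewrite !liftE // scale1r. Qed.
Lemma tscaleDr : right_distributive tscale +%R.
Proof. by move=> c x y; apply: tpow_ext => W f fm; rewrite !liftE // scalerDr. Qed.
Lemma tscaleDl x : {morph tscale^~ x : a b / a + b}.
Proof. by move=> a b; apply: tpow_ext => W f fm; rewrite !liftE // scalerDl. Qed.

HB.instance Definition _ := GRing.Zmodule_isLmodule.Build k tpow
  tscaleA tscale1 tscaleDr tscaleDl.

Lemma tlift_linear (W : lmodType k) (f : {ffun 'I_d -> V} -> W) :
  multilinear f -> linear (tlift f).
Proof. by move=> fm c x y; rewrite tlift_add // tlift_scale. Qed.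

Lemma tens_multilinear : multilinear tens.
Proof.
move=> t i c x y; apply: tpow_ext => W f fm.
by rewrite tlift_linear // !tlift_tens // fm.
Qed.

Lemma tpow_span (P : tpow -> Prop) :
  P 0 -> (forall x y, P x -> P y -> P (x + y)) -> (forall c x, P x -> P (c *: x)) ->
  (forall t, P (tens t)) -> forall x, P x.
Proof.
move=> P0 PD PZ Pt x.
suff -> : x = \sum_(p <- repr x) p.1 *: tens p.2.
  by elim/big_rec: _ => // p y _ Py; apply: PD => //; apply: PZ.
apply: tpow_ext => W f fm; rewrite (linfun_sum (tlift_linear fm)).
by rewrite {1}/tlift; apply: eq_bigr => p _; rewrite tlift_scale // tlift_tens.
Qed.

Lemma tlift_uniq (W : lmodType k) (g h : tpow -> W) :
  linear g -> linear h -> (forall t, g (tens t) = h (tens t)) -> g =1 h.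
Proof.
move=> gl hl gh; apply: tpow_span => //.
- by rewrite !linfun0.
- by move=> x y gx gy; rewrite !linfunD // gx gy.
- by move=> c x gx; rewrite !linfunZ // gx.
Qed.

End TensorPower.

Section LinearClosure.
Variables (k : comPzRingType).

Lemma comp_linear (U1 U2 U3 : lmodType k) (f : U2 -> U3) (g : U1 -> U2) :
  linear f -> linear g -> linear (fun x => f (g x)).
Proof. by move=> fl gl c x y; rewrite gl fl. Qed.

Lemma add_linear (U1 U2 : lmodType k) (f g : U1 -> U2) :
  linear f -> linear g -> linear (fun x => f x + g x).
Proof. by move=> fl gl c x y; rewrite gl fl scalerDr addrACA. Qed.

Lemma scale_linear (U1 U2 : lmodType k) (f : U1 -> U2) (a : k) :
  linear f -> linear (fun x => a *: f x).
Proof. by move=> fl c x y; rewrite fl scalerDr !scalerA mulrC. Qed.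

Lemma zero_linear (U1 U2 : lmodType k) : linear (fun _ : U1 => 0 : U2).
Proof. by move=> c x y; rewrite scaler0 addr0. Qed.

Lemma id_linear (U1 : lmodType k) : linear (fun x : U1 => x).
Proof. by []. Qed.

Lemma sum_linear (U1 U2 : lmodType k) (J : Type) (r : seq J) (P : pred J)
    (f : J -> U1 -> U2) :
  (forall j, linear (f j)) -> linear (fun x => \sum_(j <- r | P j) f j x).
Proof.
move=> fl c x y; rewrite scaler_sumr -big_split.
by apply: eq_bigr => j _; exact: fl.
Qed.

End LinearClosure.

Section Multilinear.
Variables (k : comPzRingType) (d : nat).

Lemma multilinear_comp (V V' W : lmodType k) (f : {ffun 'I_d -> V'} -> W)
    (g : 'I_d -> V -> V') :
  multilinear f -> (forall i, linear (g i)) ->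
  multilinear (fun u : {ffun 'I_d -> V} => f [ffun i => g i (u i)]).
Proof.
move=> fm gl t i c x y.
have E z : [ffun j => g j (tset t i z j)] = tset [ffun j => g j (t j)] i (g i z).
  by apply/ffunP => j; rewrite !ffunE; case: eqP => // ->.
by rewrite !E gl fm.
Qed.

Lemma multilinear_sum (V W : lmodType k) (J : Type) (r : seq J) (P : pred J)
    (F : J -> {ffun 'I_d -> V} -> W) :
  (forall j, multilinear (F j)) ->
  multilinear (fun u => \sum_(j <- r | P j) F j u).
Proof.
move=> Fm t i c x y; rewrite scaler_sumr -big_split.
by apply: eq_bigr => j _; exact: Fm.
Qed.

Lemma multilinear_scale (V W : lmodType k) (f : {ffun 'I_d -> V} -> W) (a : k) :
  multilinear f -> multilinear (fun u => a *: f u).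
Proof.
by move=> fm t i c x y; rewrite fm scalerDr !scalerA mulrC.
Qed.

Lemma multilinear0 (V W : lmodType k) (f : {ffun 'I_d -> V} -> W) (u : {ffun 'I_d -> V}) i :
  multilinear f -> u i = 0 -> f u = 0.
Proof.
move=> fm ui; have -> : u = tset u i 0.
  by apply/ffunP => j; rewrite ffunE; case: eqP => // ->.
exact: (linfun0 (fm u i)).
Qed.

Lemma multilinear_tlift (V V' W : lmodType k)
    (F : {ffun 'I_d -> V} -> {ffun 'I_d -> V'} -> W) (y : tpow d V') :
  (forall v, multilinear (F^~ v)) -> multilinear (fun u => tlift (F u) y).
Proof.
move=> Fm; rewrite /tlift /feval; apply: multilinear_sum => p.
exact/multilinear_scale/Fm.
Qed.

Lemma eq_tlift (V W : lmodType k) (f g : {ffun 'I_d -> V} -> W) x :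
  f =1 g -> tlift f x = tlift g x.
Proof. by move=> fg; apply: eq_bigr => p _; rewrite fg. Qed.

End Multilinear.

Section TensorGrading.
Variables (k : comPzRingType) (d : nat).

Definition hcompt (V : superspaceType k) (p : {ffun 'I_d -> bool})
    (u : {ffun 'I_d -> V}) : {ffun 'I_d -> V} := [ffun i => hcomp (p i) (u i)].

Definition homogt (V : superspaceType k) (p : {ffun 'I_d -> bool})
    (u : {ffun 'I_d -> V}) := forall i, homog (p i) (u i).

Definition partot (p : {ffun 'I_d -> bool}) : bool := \big[addb/false]_i p i.

Section OneSpace.
Variable V : superspaceType k.

Lemma homogt_hcompt p (u : {ffun 'I_d -> V}) : homogt p (hcompt p u).
Proof. by move=> i; rewrite ffunE; exact: homog_hcomp. Qed.

Lemma hcompt_id p (u : {ffun 'I_d -> V}) : homogt p u -> hcompt p u = u.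
Proof. by move=> h; apply/ffunP => i; rewrite ffunE h. Qed.

Lemma multilinear_hcompt (W : lmodType k) (f : {ffun 'I_d -> V} -> W) p :
  multilinear f -> multilinear (fun u => f (hcompt p u)).
Proof.
by move=> fm; apply: (multilinear_comp (g := fun i => hcomp (p i)) fm) => i; exact: hcomp_linear.
Qed.

Lemma hcompt_neq (W : lmodType k) (f : {ffun 'I_d -> V} -> W) p q (u : {ffun 'I_d -> V}) :
  multilinear f -> homogt p u -> q != p -> f (hcompt q u) = 0.
Proof.
move=> fm pu qp; have /existsP [i qpi] : [exists i, q i != p i].
  apply: contraNT qp => /existsPn h; apply/eqP/ffunP => i.
  by apply/eqP; move: (h i); rewrite negbK.
by apply: (multilinear0 (i := i) fm); rewrite ffunE (homog_neq (pu i)).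
Qed.

Lemma sum_hcompt (W : lmodType k) (f : {ffun 'I_d -> bool} -> {ffun 'I_d -> V} -> W)
    (P : pred {ffun 'I_d -> bool}) p (u : {ffun 'I_d -> V}) :
  (forall q, multilinear (f q)) -> homogt p u ->
  \sum_(q | P q) f q (hcompt q u) = if P p then f p u else 0.
Proof.
move=> fm pu; case: ifP => Pp.
  rewrite (bigD1 p) //= (hcompt_id pu) big1 ?addr0 // => q /andP [_ qp].
  exact: (hcompt_neq (fm q) pu).
rewrite big1 // => q Pq; apply: (hcompt_neq (fm q) pu).
by apply: contraTneq Pq => ->; rewrite Pp.
Qed.

Lemma tpow_hspan (P : tpow d V -> Prop) :
  P 0 -> (forall x y, P x -> P y -> P (x + y)) -> (forall c x, P x -> P (c *: x)) ->
  (forall p u, homogt p u -> P (tens u)) -> forall x, P x.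
Proof.
move=> P0 PD PZ Pt; apply: tpow_span => // u.
suff h m : forall u : {ffun 'I_d -> V},
    (forall i : 'I_d, (m <= i)%N -> exists e, homog e (u i)) -> P (tens u).
  by apply: (h d) => i; rewrite leqNgt ltn_ord.
elim: m => [|m IHm] {}u hu.
  apply: (Pt [ffun i => hcomp true (u i) == u i]) => i; rewrite ffunE.
  case: eqP => // nh; case: (hu i isT) => -[] //.
have [md|dm] := ltnP m d; last first.
  apply: IHm => i mi; have := ltn_ord i.
  by rewrite ltnNge (leq_trans dm mi).
pose i0 := Ordinal md.
have -> : u = tset u i0 (hcomp false (u i0) + hcomp true (u i0)).
  by apply/ffunP => j; rewrite ffunE hcomp_sum; case: eqP => // ->.
rewrite (linfunD (tens_multilinear u i0)).
apply: PD; apply: IHm => i mi; rewrite ffunE;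
  (case: eqVneq => [_|ne]; first by eexists; exact: homog_hcomp);
  apply: hu; rewrite ltn_neqAle mi andbT; by apply: contraNneq ne => e; apply/eqP/val_inj.
Qed.

Lemma tpow_huniq (W : lmodType k) (g h : tpow d V -> W) :
  linear g -> linear h -> (forall p u, homogt p u -> g (tens u) = h (tens u)) ->
  g =1 h.
Proof.
move=> gl hl gh; apply: tpow_hspan => //.
- by rewrite !linfun0.
- by move=> x y gx gy; rewrite !linfunD // gx gy.
- by move=> c x gx; rewrite !linfunZ // gx.
Qed.

Definition tcomp (e : bool) : tpow d V -> tpow d V :=
  tlift (fun u => \sum_(p | partot p == e) tens (hcompt p u)).

Lemma tcomp_multilinear e :
  multilinear (fun u : {ffun 'I_d -> V} => \sum_(p | partot p == e) tens (hcompt p u)).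
Proof.
by apply: multilinear_sum => p; apply: multilinear_hcompt; exact: tens_multilinear.
Qed.

Lemma tcomp_linear e : linear (tcomp e).
Proof. exact: tlift_linear (tcomp_multilinear e). Qed.

Lemma tcompE e p u : homogt p u ->
  tcomp e (tens u) = if partot p == e then tens u else 0.
Proof.
move=> pu; rewrite /tcomp tlift_tens; last exact: tcomp_multilinear.
by rewrite (sum_hcompt (f := fun=> @tens k d V) _ (fun=> @tens_multilinear _ _ _) pu).
Qed.

Lemma tcomp_tcomp e f x : tcomp e (tcomp f x) = if e == f then tcomp f x else 0.
Proof.
move: x; apply: tpow_huniq.
- exact: comp_linear (tcomp_linear e) (tcomp_linear f).
- by case: eqP => _; [exact: tcomp_linear|exact: zero_linear].
move=> p u pu; rewrite (tcompE f pu).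
case: (eqVneq (partot p) f) => [<-|ne].
  by rewrite (tcompE _ pu) eq_sym; case: eqP.
by rewrite (linfun0 (tcomp_linear e)); case: ifP.
Qed.

Lemma tcomp_sum x : tcomp false x + tcomp true x = x.
Proof.
move: x; apply: tpow_huniq.
- exact: add_linear (tcomp_linear false) (tcomp_linear true).
- exact: id_linear.
move=> p u pu; rewrite !(tcompE _ pu).
by case: (partot p); rewrite ?addr0 ?add0r.
Qed.

HB.instance Definition _ := Lmodule_isSuperspace.Build k (tpow d V)
  tcomp_linear tcomp_tcomp tcomp_sum.

Lemma homog_tens p u : homogt p u -> homog (partot p) (tens u).
Proof. by move=> pu; rewrite /homog /hcomp /= (tcompE _ pu) eqxx. Qed.

End OneSpace.

Section TensorProductMap.

Definition bilin (U V W : superspaceType k) (mu : U -> V -> W) :=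
  (forall v, linear (mu^~ v)) /\ (forall u, linear (mu u)).

Definition even2 (U V W : superspaceType k) (mu : U -> V -> W) :=
  forall e f u v, homog e u -> homog f v -> homog (e (+) f) (mu u v).

(* The exponent [p; q] of the sign rule, modulo 2. *)
Definition brk (p q : {ffun 'I_d -> bool}) : bool :=
  \big[addb/false]_(a < d) \big[addb/false]_(c < d | (a < c)%N) (p c && q a).

(* The map U^{(x)d} x V^{(x)d} -> W^{(x)d} induced with the sign rule by an even
   bilinear map mu : U x V -> W; on homogeneous tensors it is given by [tprodE].
   Products and actions on tensor powers are all instances of it. *)
Definition tprod (U V W : superspaceType k) (mu : U -> V -> W)
    (x : tpow d U) (y : tpow d V) : tpow d W :=
  tlift (fun u => tlift (fun v =>
    \sum_p \sum_q (-1) ^+ brk p q *: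
      tens [ffun i => mu (hcomp (p i) (u i)) (hcomp (q i) (v i))]) y) x.

Section Props.
Variables (U V W : superspaceType k) (mu : U -> V -> W) (mub : bilin mu).

Let inner (u : {ffun 'I_d -> U}) (v : {ffun 'I_d -> V}) : tpow d W :=
  \sum_p \sum_q (-1) ^+ brk p q *:
    tens [ffun i => mu (hcomp (p i) (u i)) (hcomp (q i) (v i))].

Let inner_l v : multilinear (inner^~ v).
Proof.
apply: multilinear_sum => p; apply: multilinear_sum => q; apply: multilinear_scale.
apply: (multilinear_comp (g := fun i x => mu (hcomp (p i) x) (hcomp (q i) (v i)))).
  exact: tens_multilinear.
by move=> i c x y; rewrite hcomp_linear; case: mub => h _; rewrite h.
Qed.

Let inner_r u : multilinear (inner u).
Proof.
apply: multilinear_sum => p; apply: multilinear_sum => q; apply: multilinear_scale.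
apply: (multilinear_comp (g := fun i x => mu (hcomp (p i) (u i)) (hcomp (q i) x))).
  exact: tens_multilinear.
by move=> i c x y; rewrite hcomp_linear; case: mub => _ h; rewrite h.
Qed.

Lemma tprod_linearl y : linear (tprod mu ^~ y).
Proof. exact/tlift_linear/(multilinear_tlift (F := inner))/inner_l. Qed.

Lemma tprod_linearr x : linear (tprod mu x).
Proof.
apply: sum_linear => p; apply: scale_linear.
exact/tlift_linear/inner_r.
Qed.

Lemma tprodE p q u v : homogt p u -> homogt q v ->
  tprod mu (tens u) (tens v) = (-1) ^+ brk p q *: tens [ffun i => mu (u i) (v i)].
Proof.
move=> pu qv; rewrite /tprod tlift_tens; last exact/(multilinear_tlift (F := inner))/inner_l.
rewrite tlift_tens; last exact: inner_r.
have [mul mur] := mub.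
pose F p' q' (u' : {ffun 'I_d -> U}) (v' : {ffun 'I_d -> V}) : tpow d W :=
  (-1) ^+ brk p' q' *: tens [ffun i => mu (u' i) (v' i)].
have Fl p' q' v' : multilinear ((F p' q')^~ v').
  apply: multilinear_scale.
  by apply: (multilinear_comp (g := fun i x => mu x (v' i))) => //; exact: tens_multilinear.
have Fr p' q' u' : multilinear (F p' q' u').
  apply: multilinear_scale.
  by apply: (multilinear_comp (g := fun i x => mu (u' i) x)) => //; exact: tens_multilinear.
transitivity (\sum_p' \sum_q' F p' q' (hcompt p' u) (hcompt q' v)).
  apply: eq_bigr => p' _; apply: eq_bigr => q' _; congr (_ *: tens _).
  by apply/ffunP => i; rewrite !ffunE.
under eq_bigr => p' _ do
  rewrite (sum_hcompt (f := fun q' => F p' q' (hcompt p' u)) _ (fun q' => Fr p' q' _) qv).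
by rewrite (sum_hcompt (f := fun p' u' => F p' q u' v) _ (fun p' => Fl p' q v) pu).
Qed.

End Props.

Lemma tpow_huniq2 (U V : superspaceType k) (W : lmodType k)
    (g h : tpow d U -> tpow d V -> W) :
  (forall y, linear (g^~ y)) -> (forall x, linear (g x)) ->
  (forall y, linear (h^~ y)) -> (forall x, linear (h x)) ->
  (forall p q u v, homogt p u -> homogt q v -> g (tens u) (tens v) = h (tens u) (tens v)) ->
  forall x y, g x y = h x y.
Proof.
move=> gl gr hl hr gh x y; move: x; apply: tpow_huniq => // p u pu.
by move: y; apply: tpow_huniq => // q v qv; exact: gh pu qv.
Qed.

Definition addpat (p q : {ffun 'I_d -> bool}) : {ffun 'I_d -> bool} :=
  [ffun i => p i (+) q i].

Lemma homogt_mu (U V W : superspaceType k) (mu : U -> V -> W) p q u v :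
  even2 mu -> homogt p u -> homogt q v ->
  homogt (addpat p q) [ffun i => mu (u i) (v i)].
Proof. by move=> mue pu qv i; rewrite !ffunE; exact: mue. Qed.

Lemma partot_addpat p q : partot (addpat p q) = partot p (+) partot q.
Proof.
by rewrite /partot -big_split; apply: eq_bigr => i _; rewrite ffunE.
Qed.

Lemma tprod_even (U V W : superspaceType k) (mu : U -> V -> W) :
  bilin mu -> even2 mu -> even2 (tprod mu).
Proof.
move=> mub mue e f x y <- <-; rewrite /homog.
move: x y; apply: tpow_huniq2 => [y|x|y|x|p q u v pu qv].
- by apply: comp_linear (hcomp_linear _) _ ; apply: comp_linear (tprod_linearl mub _) (hcomp_linear _).
- by apply: comp_linear (hcomp_linear _) _ ; apply: comp_linear (tprod_linearr mub _) (hcomp_linear _).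
- exact: comp_linear (tprod_linearl mub _) (hcomp_linear _).
- exact: comp_linear (tprod_linearr mub _) (hcomp_linear _).
rewrite /= (homogE e (homog_tens pu)) (homogE f (homog_tens qv)).
case: eqP => [->|_]; last by rewrite (linfun0 (tprod_linearl mub _)) hcomp0.
case: eqP => [->|_]; last by rewrite (linfun0 (tprod_linearr mub _)) hcomp0.
rewrite (tprodE mub pu qv); apply: homogZ; rewrite -partot_addpat.
exact/homog_tens/homogt_mu.
Qed.

Lemma addbA4 a b c e : (a (+) b) (+) (c (+) e) = (a (+) c) (+) (b (+) e).
Proof. by case: a b c e => [] [] [] []. Qed.

Lemma brkDl p q r : brk (addpat p q) r = brk p r (+) brk q r.
Proof.
rewrite /brk -big_split; apply: eq_bigr => a _.
by rewrite -big_split; apply: eq_bigr => c _; rewrite ffunE andb_addl.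
Qed.

Lemma brkDr p q r : brk p (addpat q r) = brk p q (+) brk p r.
Proof.
rewrite /brk -big_split; apply: eq_bigr => a _.
by rewrite -big_split; apply: eq_bigr => c _; rewrite ffunE andb_addr.
Qed.

Lemma tprodA (U V W X Y Z : superspaceType k) (mu1 : U -> V -> X) (mu2 : X -> W -> Y)
    (mu3 : V -> W -> Z) (mu4 : U -> Z -> Y) :
  bilin mu1 -> bilin mu2 -> bilin mu3 -> bilin mu4 -> even2 mu1 -> even2 mu3 ->
  (forall u v w, mu2 (mu1 u v) w = mu4 u (mu3 v w)) ->
  forall x y z, tprod mu2 (tprod mu1 x y) z = tprod mu4 x (tprod mu3 y z).
Proof.
move=> b1 b2 b3 b4 e1 e3 H x y z; move: x y.
apply: tpow_huniq2 => [y|x|y|x|p q u v pu qv].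
- exact: comp_linear (tprod_linearl b2 _) (tprod_linearl b1 _).
- exact: comp_linear (tprod_linearl b2 _) (tprod_linearr b1 _).
- exact: tprod_linearl b4 _.
- exact: comp_linear (tprod_linearr b4 _) (tprod_linearl b3 _).
move: z; apply: tpow_huniq => [||r w rw].
- exact: tprod_linearr b2 _.
- exact: comp_linear (tprod_linearr b4 _) (tprod_linearr b3 _).
rewrite (tprodE b1 pu qv) (tprodE b3 qv rw).
rewrite (linfunZ (tprod_linearl b2 _)) (linfunZ (tprod_linearr b4 _)).
rewrite (tprodE b2 (homogt_mu e1 pu qv) rw) (tprodE b4 pu (homogt_mu e3 qv rw)).
rewrite !scalerA -!signr_addb brkDl brkDr; congr (_ *: tens _); last first.
  by apply/ffunP => i; rewrite !ffunE H.
by congr (_ ^+ nat_of_bool _); case: (brk p q) (brk p r) (brk q r) => [] [] [].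
Qed.

End TensorProductMap.
End TensorGrading.

Section BoolDoubleSum.
Variable d : nat.
Implicit Types F G : 'I_d -> 'I_d -> bool.

Let D F := \big[addb/false]_(a < d) \big[addb/false]_(c < d) F a c.

Let eqD F G : (forall a c, F a c = G a c) -> D F = D G.
Proof. by move=> FG; apply: eq_bigr => a _; apply: eq_bigr => c _; exact: FG. Qed.

Let addD F G : D F (+) D G = D (fun a c => F a c (+) G a c).
Proof. by rewrite /D -big_split; apply: eq_bigr => a _; rewrite -big_split. Qed.

Let swapD F : D F = D (fun a c => F c a).
Proof. exact: exchange_big. Qed.

Let permD (g : 'S_d) F : D F = D (fun a c => F (g a) (g c)).
Proof.
rewrite /D (reindex_inj (@perm_inj _ g)); apply: eq_bigr => a _.
exact: (reindex_inj (@perm_inj _ g)).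
Qed.

Let condD (R F : 'I_d -> 'I_d -> bool) :
  \big[addb/false]_(a < d) \big[addb/false]_(c < d | R a c) F a c
  = D (fun a c => R a c && F a c).
Proof.
apply: eq_bigr => a _; rewrite big_mkcond; apply: eq_bigr => c _.
by case: (R a c).
Qed.

Let ltV (g : 'S_d) (a c : 'I_d) : (a < c)%N -> (g a < g c)%N = ~~ (g c < g a)%N.
Proof.
move=> ac; rewrite -leqNgt [RHS]leq_eqVlt.
by case: (eqVneq (g a : nat) (g c)) => [e|]; [rewrite (perm_inj (val_inj e)) ltnn in ac|].
Qed.

(* The exponent m of the action of g, modulo 2. *)
Definition inv_par (g : 'S_d) (p : {ffun 'I_d -> bool}) : bool :=
  \big[addb/false]_(a < d) \big[addb/false]_(c < d | (a < c)%N && (g^-1%g c < g^-1%g a)%N)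
    (p a && p c).

Definition psact (T : Type) (g : 'S_d) (u : {ffun 'I_d -> T}) : {ffun 'I_d -> T} :=
  [ffun i => u (g i)].

Let pullD (g : 'S_d) F :
  D (fun a c => (a < c)%N && F (g a) (g c)) =
  D (fun a c => (a < c)%N && (((g^-1%g a < g^-1%g c)%N && F a c) (+)
                              ((g^-1%g c < g^-1%g a)%N && F c a))).
Proof.
transitivity (D (fun a c => (g^-1%g a < g^-1%g c)%N && F a c)).
  by rewrite (permD g (fun a c => (g^-1%g a < g^-1%g c)%N && F a c)); apply: eqD => a c; rewrite !permK.
transitivity (D (fun a c => (a < c)%N && ((g^-1%g a < g^-1%g c)%N && F a c)) (+)
              D (fun a c => (c < a)%N && ((g^-1%g a < g^-1%g c)%N && F a c))).
  rewrite addD; apply: eqD => a c; case: (ltngtP a c) => [_|_|/val_inj ->] //=.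
    by rewrite addbF.
  by rewrite ltnn.
rewrite [X in _ (+) X]swapD addD; apply: eqD => a c.
by rewrite andb_addr.
Qed.

Lemma inv_parM (g h : 'S_d) p :
  inv_par g p (+) inv_par h (psact g p) = inv_par (h * g)%g p.
Proof.
rewrite /inv_par !condD.
pose F x y :=
  ((g^-1%g x < g^-1%g y)%N (+) (h^-1%g (g^-1%g x) < h^-1%g (g^-1%g y))%N) && (p x && p y).
have -> : D (fun a c => (a < c)%N && (h^-1%g c < h^-1%g a)%N && (psact g p a && psact g p c))
  = D (fun a c => (a < c)%N && F (g a) (g c)).
  apply: eqD => a c; rewrite /F !ffunE !permK; case ac: (a < c)%N => //=.
  by rewrite (ltV h^-1%g ac) negbK.
rewrite (pullD g F) addD; apply: eqD => a c; case ac: (a < c)%N => //=.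
rewrite /F invMg !permM (ltV g^-1%g ac).
case gac: (g^-1%g c < g^-1%g a)%N => /=.
  rewrite (ltV h^-1%g gac) /=; case: (p a) (p c) => [] [] //=; case: (_ < _)%N => //.
have gac' : (g^-1%g a < g^-1%g c)%N by rewrite (ltV g^-1%g ac) gac.
by rewrite (ltV h^-1%g gac') negbK addbF.
Qed.

Lemma inv_par1 p : inv_par 1%g p = false.
Proof.
rewrite /inv_par condD /D big1 // => a _; rewrite big1 // => c _.
by rewrite invg1 !perm1; case: ltngtP.
Qed.

Lemma inv_par_brk (g : 'S_d) p q :
  inv_par g (addpat p q) (+) brk p q
  = (inv_par g p (+) inv_par g q) (+) brk (psact g p) (psact g q).
Proof.
rewrite /inv_par /brk !condD.
pose F x y := p y && q x.
have -> : D (fun a c => (a < c)%N && (psact g p c && psact g q a)) =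
  D (fun a c => (a < c)%N && F (g a) (g c)).
  by apply: eqD => a c; rewrite !ffunE.
rewrite (pullD g F) !addD; apply: eqD => a c; case ac: (a < c)%N => //=.
rewrite /F !ffunE (ltV g^-1%g ac); case: (_ < _)%N => /=;
by case: (p a) (p c) (q a) (q c) => [] [] [] [].
Qed.

End BoolDoubleSum.

Section PermAction.
Variables (k : comPzRingType) (d : nat).
Implicit Types g h : 'S_d.

Lemma partot_psact g p : partot (psact g p) = partot p.
Proof.
rewrite /partot [RHS](reindex_inj (@perm_inj _ g)).
by apply: eq_bigr => i _; rewrite ffunE.
Qed.

Section OneSpace.
Variable V : superspaceType k.

(* The right action x^g.  Beware that the product of g and h as composed maps,
   "first h, then g", is (h * g)%g in the library; cf. [tactM]. *)
Definition tact g (x : tpow d V) : tpow d V :=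
  tlift (fun u => \sum_p (-1) ^+ inv_par g p *: tens (psact g (hcompt p u))) x.

Let psact_multilinear g p :
  multilinear (fun u : {ffun 'I_d -> V} => (-1) ^+ inv_par g p *: tens (psact g u)).
Proof.
apply: multilinear_scale => t i c x y.
have E z : psact g (tset t i z) = tset (psact g t) (g^-1%g i) z.
  by apply/ffunP => j; rewrite !ffunE -[j == _](inj_eq (@perm_inj _ g)) permKV.
by rewrite !E tens_multilinear.
Qed.

Let tact_multilinear g :
  multilinear (fun u : {ffun 'I_d -> V} =>
    \sum_p (-1) ^+ inv_par g p *: tens (psact g (hcompt p u))).
Proof.
apply: multilinear_sum => p.
exact: (multilinear_hcompt (f := fun u => (-1) ^+ inv_par g p *: tens (psact g u))).
Qed.

Lemma tact_linear g : linear (tact g).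
Proof. exact/tlift_linear/tact_multilinear. Qed.

Lemma tactE g p u : homogt p u ->
  tact g (tens u) = (-1) ^+ inv_par g p *: tens (psact g u).
Proof.
move=> pu; rewrite /tact tlift_tens; last exact: tact_multilinear.
exact: (sum_hcompt (f := fun p u => (-1) ^+ inv_par g p *: tens (psact g u)) _ _ pu).
Qed.

Lemma homogt_psact g p (u : {ffun 'I_d -> V}) : homogt p u -> homogt (psact g p) (psact g u).
Proof. by move=> pu i; rewrite !ffunE. Qed.

Lemma tactM g h x : tact h (tact g x) = tact (h * g)%g x.
Proof.
move: x; apply: tpow_huniq => [||p u pu].
- exact: comp_linear (tact_linear h) (tact_linear g).
- exact: tact_linear.
rewrite (tactE g pu) (tactE _ pu) (linfunZ (tact_linear h)).
rewrite (tactE h (homogt_psact g pu)) scalerA -signr_addb inv_parM.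
by congr (_ *: tens _); apply/ffunP => i; rewrite !ffunE permM.
Qed.

Lemma tact1 x : tact 1%g x = x.
Proof.
move: x; apply: tpow_huniq => [||p u pu]; [exact: tact_linear|by []|].
rewrite (tactE _ pu) inv_par1 scale1r; congr tens.
by apply/ffunP => i; rewrite !ffunE perm1.
Qed.

Lemma hcomp_tact e g x : hcomp e (tact g x) = tact g (hcomp e x).
Proof.
move: x; apply: tpow_huniq => [||p u pu].
- exact: comp_linear (hcomp_linear _) (tact_linear g).
- exact: comp_linear (tact_linear g) (hcomp_linear _).
rewrite (homogE e (homog_tens pu)) (tactE g pu) hcompZ.
rewrite (homogE e (homog_tens (homogt_psact g pu))) partot_psact.
by case: eqP => _; rewrite ?(tactE g pu) // scaler0 (linfun0 (tact_linear g)).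
Qed.

Lemma homog_tact e g x : homog e x -> homog e (tact g x).
Proof. by rewrite /homog hcomp_tact => ->. Qed.

End OneSpace.

Lemma tact_tprod (U V W : superspaceType k) (mu : U -> V -> W) g x y :
  bilin mu -> even2 mu ->
  tact g (tprod mu x y) = tprod mu (tact g x) (tact g y).
Proof.
move=> mub mue; move: x y; apply: tpow_huniq2 => [y|x|y|x|p q u v pu qv].
- exact: comp_linear (tact_linear g) (tprod_linearl mub _).
- exact: comp_linear (tact_linear g) (tprod_linearr mub _).
- exact: comp_linear (tprod_linearl mub _) (tact_linear g).
- exact: comp_linear (tprod_linearr mub _) (tact_linear g).
rewrite (tprodE mub pu qv) (linfunZ (tact_linear g)) (tactE g (homogt_mu mue pu qv)).
rewrite (tactE g pu) (tactE g qv).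
rewrite (linfunZ (tprod_linearl mub _)) (linfunZ (tprod_linearr mub _)).
rewrite (tprodE mub (homogt_psact g pu) (homogt_psact g qv)) !scalerA -!signr_addb.
rewrite addbC inv_par_brk; congr (_ *: tens _).
by apply/ffunP => i; rewrite !ffunE.
Qed.

End PermAction.

Section TensorAlgebra.
Variables (k : comPzRingType).

Lemma smul_bilin (A : superalgType k) : bilin (@smul k A).
Proof. by split; [exact: smul_linearl|exact: smul_linearr]. Qed.

Lemma smul_even (A : superalgType k) : even2 (@smul k A).
Proof. by move=> e f u v; exact: homog_smul. Qed.

Lemma homog_sone (A : superalgType k) : homog false (sone : A).
Proof.
pose e0 : A := hcomp false sone; pose e1 : A := hcomp true sone.
have Dl (x y z : A) : (x + y) ** z = x ** z + y ** z.
  exact: (linfunD (smul_linearl z)).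
have Dr (x y z : A) : z ** (x + y) = z ** x + z ** y.
  exact: (linfunD (smul_linearr z)).
have h e (x : A) : homog e x -> x ** e1 = 0.
  move=> hx; have E : x = x ** e0 + x ** e1 by rewrite -Dr hcomp_sum smulx1.
  have h0 : homog e (x ** e0).
    by rewrite -[e]addbF; exact: homog_smul hx (homog_hcomp _ _).
  have h1 : homog (~~ e) (x ** e1).
    by rewrite -addbT; exact: homog_smul hx (homog_hcomp _ _).
  have := congr1 (hcomp (~~ e)) E; rewrite hcompD (homogE _ hx) (homogE _ h0) h1.
  by case: (e); rewrite /= add0r.
have e10 : e1 = 0.
  rewrite -[e1]smul1x -[X in X ** _]hcomp_sum Dl.
  by rewrite !(h _ _ (homog_hcomp _ _)) addr0.
by rewrite /homog -[RHS](hcomp_sum sone) -/e1 e10 addr0.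
Qed.

Variables (d : nat) (A : superalgType k).

Definition tmul : tpow d A -> tpow d A -> tpow d A := tprod (@smul k A).
Definition tone : tpow d A := tens [ffun=> sone].

Lemma homogt_sone : homogt [ffun=> false] [ffun _ : 'I_d => sone : A].
Proof. by move=> i; rewrite !ffunE; exact: homog_sone. Qed.

Lemma brk0l (q : {ffun 'I_d -> bool}) : brk [ffun=> false] q = false.
Proof. by rewrite /brk big1 // => a _; rewrite big1 // => c _; rewrite ffunE. Qed.

Lemma brk0r (q : {ffun 'I_d -> bool}) : brk q [ffun=> false] = false.
Proof. by rewrite /brk big1 // => a _; rewrite big1 // => c _; rewrite ffunE andbF. Qed.

Lemma tprod1r (V : superspaceType k) (mu : V -> A -> V) :
  bilin mu -> (forall v, mu v sone = v) -> forall x, tprod mu x tone = x.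
Proof.
move=> mub mu1; apply: tpow_huniq => [||p u pu] //; first exact: tprod_linearl.
rewrite (tprodE mub pu homogt_sone) brk0r scale1r; congr tens.
by apply/ffunP => i; rewrite !ffunE mu1.
Qed.

Lemma tprod1l (V : superspaceType k) (mu : A -> V -> V) :
  bilin mu -> (forall v, mu sone v = v) -> forall x, tprod mu tone x = x.
Proof.
move=> mub mu1; apply: tpow_huniq => [||p u pu] //; first exact: tprod_linearr.
rewrite (tprodE mub homogt_sone pu) brk0l scale1r; congr tens.
by apply/ffunP => i; rewrite !ffunE mu1.
Qed.

Lemma tmulA : associative tmul.
Proof.
move=> x y z; apply/esym; apply: tprodA; try exact: smul_bilin; try exact: smul_even.
by move=> u v w; rewrite smulA.
Qed.

Lemma tmul1x : left_id tone tmul.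
Proof. exact: tprod1l (@smul_bilin A) (@smul1x _ A). Qed.

Lemma tmulx1 : right_id tone tmul.
Proof. exact: tprod1r (@smul_bilin A) (@smulx1 _ A). Qed.

HB.instance Definition _ := Superspace_isSuperalgebra.Build k (tpow d A)
  tmulA tmul1x tmulx1
  (tprod_linearl (@smul_bilin A)) (tprod_linearr (@smul_bilin A))
  (tprod_even (@smul_bilin A) (@smul_even A)).

Lemma tact_smul (g : 'S_d) (x y : tpow d A) : tact g (x ** y) = tact g x ** tact g y.
Proof. exact: tact_tprod (@smul_bilin A) (@smul_even A). Qed.

Lemma tact_sone (g : 'S_d) : tact g (sone : tpow d A) = sone.
Proof.
rewrite /sone /= /tone (tactE g homogt_sone).
have -> : inv_par g [ffun _ : 'I_d => false] = false.
  by rewrite /inv_par big1 // => a _; rewrite big1 // => c _; rewrite ffunE.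
by rewrite scale1r; congr tens; apply/ffunP => i; rewrite !ffunE.
Qed.

End TensorAlgebra.

Section Wreath.
Variables (k : comPzRingType) (d : nat) (A : superalgType k).
Implicit Types (w : {ffun 'S_d -> tpow d A}) (g h : 'S_d) (x y : tpow d A).

(* An element w stands for the sum of the w g (x) g. *)
Definition wreath := {ffun 'S_d -> tpow d A}.
HB.instance Definition _ := GRing.Lmodule.on wreath.

Definition wcomp e (w : wreath) : wreath := [ffun g => hcomp e (w g)].

Lemma wcomp_linear e : linear (wcomp e).
Proof. by move=> c w w'; apply/ffunP => g; rewrite !ffunE hcomp_linear. Qed.

Lemma wcomp_wcomp e f w : wcomp e (wcomp f w) = if e == f then wcomp f w else 0.
Proof. by apply/ffunP => g; rewrite !ffunE hcomp_hcomp; case: eqP; rewrite ffunE. Qed.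

Lemma wcomp_sum w : wcomp false w + wcomp true w = w.
Proof. by apply/ffunP => g; rewrite !ffunE hcomp_sum. Qed.

HB.instance Definition _ := Lmodule_isSuperspace.Build k wreath
  wcomp_linear wcomp_wcomp wcomp_sum.

Definition wmono (x : tpow d A) (g : 'S_d) : wreath :=
  [ffun h => if h == g then x else 0].

(* (x (x) g)(y (x) h) = x y^(g^-1) (x) gh, which amounts to g^-1 x g = x^g
   (lemma [wmul_conj]). *)
Definition wmul (w w' : wreath) : wreath :=
  \sum_g \sum_h wmono (w g ** tact g^-1%g (w' h)) (h * g)%g.
Definition wone : wreath := wmono sone 1%g.

Lemma wmono_linear g : linear (wmono ^~ g).
Proof.
by move=> c x y; apply/ffunP => h; rewrite !ffunE; case: eqP => // _; rewrite scaler0 addr0.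
Qed.

Lemma wmono_sum (w : wreath) : w = \sum_g wmono (w g) g.
Proof.
apply/ffunP => h; rewrite sum_ffunE (bigD1 h) //= ffunE eqxx big1 ?addr0 // => g gh.
by rewrite ffunE eq_sym (negPf gh).
Qed.

Lemma wreath_uniq (U : lmodType k) (f f' : wreath -> U) :
  linear f -> linear f' -> (forall x g, f (wmono x g) = f' (wmono x g)) -> f =1 f'.
Proof.
move=> fl fl' ff' w; rewrite [w]wmono_sum !linfun_sum //.
by apply: eq_bigr => g _.
Qed.

Lemma coef_linear g : linear (fun w : wreath => w g).
Proof. by move=> c w w'; rewrite !ffunE. Qed.

Lemma wmul_bilin : bilin wmul.
Proof.
split=> [w'|w]; apply: sum_linear => g; apply: sum_linear => h.
  apply: (comp_linear (wmono_linear (h * g)%g)).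
  exact: (comp_linear (smul_linearl (tact g^-1%g (w' h))) (coef_linear g)).
apply: (comp_linear (wmono_linear (h * g)%g)).
apply: (comp_linear (smul_linearr (w g))).
exact: (comp_linear (@tact_linear _ _ _ g^-1%g) (coef_linear h)).
Qed.

Lemma wmono0 g : wmono 0 g = 0.
Proof. exact: linfun0 (wmono_linear g). Qed.

Lemma wmulE x y g h :
  wmul (wmono x g) (wmono y h) = wmono (x ** tact g^-1%g y) (h * g)%g.
Proof.
rewrite /wmul (bigD1 g) //= [X in _ + X]big1 => [|g' gg']; last first.
  rewrite big1 // => h' _.
  by rewrite ffunE (negPf gg') (linfun0 (smul_linearl _)) wmono0.
rewrite addr0 (bigD1 h) //= [X in _ + X]big1 => [|h' hh'].
  by rewrite addr0 !ffunE !eqxx.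
by rewrite !ffunE (negPf hh') (linfun0 (tact_linear _)) (linfun0 (smul_linearr _)) wmono0.
Qed.

Lemma wmulA : associative wmul.
Proof.
have [bl br] := wmul_bilin.
move=> w1 w2 w3; move: w1; apply: wreath_uniq => [||x g].
- exact: bl.
- exact: comp_linear (bl _) (bl _).
move: w2; apply: wreath_uniq => [||y h].
- exact: comp_linear (br _) (bl _).
- exact: comp_linear (bl _) (br _).
move: w3; apply: wreath_uniq => [||z l].
- exact: comp_linear (br _) (br _).
- exact: br.
by rewrite !wmulE tact_smul tactM smulA invMg mulgA.
Qed.

Lemma wmul1x : left_id wone wmul.
Proof.
have [bl br] := wmul_bilin.
apply: wreath_uniq => // x g.
by rewrite wmulE invg1 tact1 smul1x mulg1.
Qed.

Lemma wmulx1 : right_id wone wmul.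
Proof.
have [bl br] := wmul_bilin.
apply: wreath_uniq => // x g.
by rewrite wmulE tact_sone smulx1 mul1g.
Qed.

Lemma wmul_conj x g :
  wmul (wmul (wmono sone g^-1%g) (wmono x 1%g)) (wmono sone g) = wmono (tact g x) 1%g.
Proof. by rewrite !wmulE invgK smul1x tact_sone smulx1 mul1g mulgV. Qed.

Lemma homog_wmono e x g : homog e x -> homog e (wmono x g).
Proof.
move=> hx; apply/ffunP => h; rewrite !ffunE; case: eqP => // _; exact: hcomp0.
Qed.

Lemma homog_coef e (w : wreath) g : homog e w -> homog e (w g).
Proof. by move=> /ffunP /(_ g); rewrite ffunE. Qed.

Lemma wmul_even : even2 wmul.
Proof.
move=> e f w w' hw hw'; apply: homog_sum => g _; apply: homog_sum => h _.
apply/homog_wmono/homog_smul; first exact: homog_coef.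
exact/homog_tact/homog_coef.
Qed.

HB.instance Definition _ := Superspace_isSuperalgebra.Build k wreath
  wmulA wmul1x wmulx1 (proj1 wmul_bilin) (proj2 wmul_bilin) wmul_even.

End Wreath.

Section MatrixSpaces.
Variables (k : comPzRingType) (A : superalgType k).

(* A as a ring of the library, so as to use its matrices. *)
Definition sring : Type := A.
HB.instance Definition _ := GRing.Zmodule.on sring.

Lemma smulDl : left_distributive (@smul k A) +%R.
Proof. by move=> x y z; exact: (linfunD (smul_linearl z)). Qed.

Lemma smulDr : right_distributive (@smul k A) +%R.
Proof. by move=> x y z; exact: (linfunD (smul_linearr x)). Qed.

HB.instance Definition _ := GRing.Zmodule_isPzRing.Build sring
  (@smulA k A) (@smul1x k A) (@smulx1 k A) smulDl smulDr.

Definition mxk (m n : nat) := 'M[sring]_(m, n).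

Section Fixed.
Variables m n : nat.
Implicit Types M N : mxk m n.
HB.instance Definition _ := GRing.Zmodule.on (mxk m n).

Definition mxk_scale (c : k) (M : mxk m n) : mxk m n :=
  map_mx (fun x : A => c *: x) M.

Lemma mxk_scaleA a b M : mxk_scale a (mxk_scale b M) = mxk_scale (a * b) M.
Proof. by apply/matrixP => i j; rewrite !mxE scalerA. Qed.
Lemma mxk_scale1 : left_id 1 mxk_scale.
Proof. by move=> M; apply/matrixP => i j; rewrite !mxE scale1r. Qed.
Lemma mxk_scaleDr : right_distributive mxk_scale +%R.
Proof. by move=> c M N; apply/matrixP => i j; rewrite !mxE scalerDr. Qed.
Lemma mxk_scaleDl M : {morph mxk_scale^~ M : a b / a + b}.
Proof. by move=> a b; apply/matrixP => i j; rewrite !mxE scalerDl. Qed.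

HB.instance Definition _ := GRing.Zmodule_isLmodule.Build k (mxk m n)
  mxk_scaleA mxk_scale1 mxk_scaleDr mxk_scaleDl.

Definition mxk_comp (e : bool) (M : mxk m n) : mxk m n :=
  map_mx (fun x : A => hcomp e x) M.

Lemma mxk_scaleE (c : k) M i j : (c *: M) i j = c *: (M i j : A).
Proof. by rewrite mxE. Qed.

Lemma mxk_comp_linear e : linear (mxk_comp e).
Proof.
by move=> c M N; apply/matrixP => i j; rewrite !mxE hcomp_linear.
Qed.
Lemma mxk_comp_comp e f M : mxk_comp e (mxk_comp f M) = if e == f then mxk_comp f M else 0.
Proof.
by apply/matrixP => i j; rewrite !mxE hcomp_hcomp; case: eqP; rewrite !mxE.
Qed.
Lemma mxk_comp_sum M : mxk_comp false M + mxk_comp true M = M.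
Proof. by apply/matrixP => i j; rewrite !mxE hcomp_sum. Qed.

HB.instance Definition _ := Lmodule_isSuperspace.Build k (mxk m n)
  mxk_comp_linear mxk_comp_comp mxk_comp_sum.

Lemma mxk_homogP e M : homog e M <-> forall i j, homog e (M i j : A).
Proof.
split=> [/matrixP h i j|h]; first by have := h i j; rewrite mxE.
by apply/matrixP => i j; rewrite mxE h.
Qed.
End Fixed.

Definition mxk_mul (m n p : nat) (M : mxk m n) (N : mxk n p) : mxk m p := M *m N.

Lemma mxk_mul_bilin m n p : bilin (@mxk_mul m n p).
Proof.
split=> [N c M M'|M c N N']; apply/matrixP => i j; rewrite !mxE scaler_sumr -big_split;
  apply: eq_bigr => l _; rewrite !mxE.
  exact: smul_linearl.
exact: smul_linearr.
Qed.

Lemma mxk_mul_even m n p : even2 (@mxk_mul m n p).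
Proof.
move=> e f M N /mxk_homogP hM /mxk_homogP hN; apply/mxk_homogP => i j.
rewrite mxE; apply: homog_sum => l _; exact: homog_smul.
Qed.

HB.instance Definition _ n := Superspace_isSuperalgebra.Build k (mxk n n)
  (@mulmxA sring n n n n) (@mul1mx sring n n) (@mulmx1 sring n n)
  (proj1 (@mxk_mul_bilin n n n)) (proj2 (@mxk_mul_bilin n n n)) (@mxk_mul_even n n n).

(* The right action of A on column vectors. *)
Definition colact (n : nat) (v : mxk n 1) (a : A) : mxk n 1 :=
  map_mx (fun x : A => x ** a) v.

End MatrixSpaces.

Section RightSupermodules.
Variable k : comPzRingType.

Record rsupermod (B : superalgType k) (V : superspaceType k) := Rsupermod {
  ract :> V -> B -> V;
  ract_bilin : bilin ract;
  ract_even : even2 ract;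
  ract1 : forall v, ract v sone = v;
  ractM : forall v a b, ract (ract v a) b = ract v (a ** b) }.

Lemma colact_bilin (A : superalgType k) n : bilin (@colact k A n).
Proof.
split=> [a c v v'|v c a b]; apply/matrixP => i j; rewrite !mxE.
  exact: smul_linearl.
exact: smul_linearr.
Qed.

Lemma colact_even (A : superalgType k) n : even2 (@colact k A n).
Proof.
move=> e f v a /mxk_homogP hv ha; apply/mxk_homogP => i j; rewrite mxE.
exact: homog_smul.
Qed.

Lemma colact1 (A : superalgType k) n (v : mxk A n 1) : colact v sone = v.
Proof. by apply/matrixP => i j; rewrite mxE smulx1. Qed.

Lemma colactM (A : superalgType k) n (v : mxk A n 1) a b :
  colact (colact v a) b = colact v (a ** b).
Proof. by apply/matrixP => i j; rewrite !mxE smulA. Qed.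

Definition col_mod (A : superalgType k) (n : nat) : rsupermod A (mxk A n 1) :=
  Rsupermod (@colact_bilin A n) (@colact_even A n) (@colact1 A n) (@colactM A n).

Section TensorModule.
Variables (d : nat) (A : superalgType k) (V : superspaceType k) (rho : rsupermod A V).

Definition tpow_act : tpow d V -> tpow d A -> tpow d V := tprod rho.

Lemma tpow_act_bilin : bilin tpow_act.
Proof.
by split; [exact: tprod_linearl (ract_bilin rho)|exact: tprod_linearr (ract_bilin rho)].
Qed.

Lemma tpow_act_even : even2 tpow_act.
Proof. exact: tprod_even (ract_bilin rho) (@ract_even _ _ rho). Qed.

Lemma tpow_act1 x : tpow_act x sone = x.
Proof. exact: tprod1r (ract_bilin rho) (ract1 rho) x. Qed.

Lemma tpow_actM x a b : tpow_act (tpow_act x a) b = tpow_act x (a ** b).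
Proof.
apply: tprodA; [exact: ract_bilin|exact: ract_bilin|exact: smul_bilin|exact: ract_bilin
  |exact: ract_even|exact: smul_even|exact: ractM].
Qed.

Definition tpow_mod : rsupermod (tpow d A) (tpow d V) :=
  Rsupermod tpow_act_bilin tpow_act_even tpow_act1 tpow_actM.

Definition wreath_act (x : tpow d V) (w : wreath d A) : tpow d V :=
  \sum_g tact g (tpow_act x (w g)).

Lemma wreath_act_bilin : bilin wreath_act.
Proof.
have [bl br] := tpow_act_bilin.
split=> [w|x]; apply: sum_linear => g; apply: (comp_linear (@tact_linear _ _ _ g)).
  exact: bl.
exact: comp_linear (br _) (@coef_linear _ _ _ g).
Qed.

Lemma wreath_act_even : even2 wreath_act.
Proof.
move=> e f x w hx hw; apply: homog_sum => g _; apply: homog_tact.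
exact/tpow_act_even/homog_coef.
Qed.

Lemma wreath_actE x a g : wreath_act x (wmono a g) = tact g (tpow_act x a).
Proof.
rewrite /wreath_act (bigD1 g) //= big1 => [|h hg]; first by rewrite addr0 ffunE eqxx.
rewrite ffunE (negPf hg) (linfun0 (proj2 tpow_act_bilin x)).
exact: linfun0 (tact_linear h).
Qed.

Lemma wreath_act1 x : wreath_act x sone = x.
Proof. by rewrite wreath_actE tact1 tpow_act1. Qed.

Lemma wreath_actM x w w' : wreath_act (wreath_act x w) w' = wreath_act x (w ** w').
Proof.
have [bl br] := wreath_act_bilin.
move: w; apply: wreath_uniq => [||a g].
- exact: comp_linear (bl _) (br _).
- exact: comp_linear (br _) (smul_linearl _).
move: w'; apply: wreath_uniq => [||b h].
- exact: br.
- exact: comp_linear (br _) (smul_linearr _).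
rewrite [wmono a g ** wmono b h]wmulE !wreath_actE -tactM -tpow_actM.
rewrite /tpow_act [in RHS](tact_tprod g) ?tactM ?mulVg; last 2 first.
- exact: ract_bilin.
- exact: ract_even.
by rewrite mulgV tact1.
Qed.

Definition wreath_mod : rsupermod (wreath d A) (tpow d V) :=
  Rsupermod wreath_act_bilin wreath_act_even wreath_act1 wreath_actM.

End TensorModule.

End RightSupermodules.

Section EndomorphismAlgebra.
Variables (k : comPzRingType) (B : superalgType k) (V : superspaceType k).
Variable rho : rsupermod B V.

(* All B-linear endomorphisms, even and odd; they act on the left, so no sign
   appears in [send_act]. *)
Record sEnd := SEnd {
  send_fun :> V -> V;
  send_linear : linear send_fun;
  send_act : forall v b, send_fun (rho v b) = rho (send_fun v) b }.

HB.instance Definition _ := gen_eqMixin sEnd.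
HB.instance Definition _ := gen_choiceMixin sEnd.

Implicit Types f g : sEnd.

Lemma send_ext f g : (forall v, f v = g v) -> f = g.
Proof.
case: f g => [f fl fa] [g gl ga] /= fg.
have E : f = g by apply/funext.
by subst g; congr SEnd; exact: Prop_irrelevance.
Qed.

Lemma send_hext f g : (forall a v, homog a v -> f v = g v) -> f = g.
Proof.
move=> fg; apply: send_ext => v.
rewrite -[v]hcomp_sum !linfunD; try exact: send_linear.
by rewrite !(fg _ _ (homog_hcomp _ _)).
Qed.

Let rl b : linear (rho^~ b) := proj1 (ract_bilin rho) b.
Let rr v : linear (rho v) := proj2 (ract_bilin rho) v.

Program Definition send_add f g := @SEnd (fun v => f v + g v) _ _.
Next Obligation. exact: add_linear (send_linear f) (send_linear g). Qed.
Next Obligation. by rewrite !send_act (linfunD (rl b)). Qed.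

Program Definition send_zero := @SEnd (fun=> 0) _ _.
Next Obligation. exact: zero_linear. Qed.
Next Obligation. by rewrite (linfun0 (rl b)). Qed.

Program Definition send_scale (c : k) f := @SEnd (fun v => c *: f v) _ _.
Next Obligation. exact: scale_linear (send_linear f). Qed.
Next Obligation. by rewrite !send_act (linfunZ (rl b)). Qed.

Definition send_opp := send_scale (-1).

Lemma send_addA : associative send_add.
Proof. by move=> f g h; apply: send_ext => v; exact: addrA. Qed.
Lemma send_addC : commutative send_add.
Proof. by move=> f g; apply: send_ext => v; exact: addrC. Qed.
Lemma send_add0 : left_id send_zero send_add.
Proof. by move=> f; apply: send_ext => v; exact: add0r. Qed.
Lemma send_addN : left_inverse send_zero send_opp send_add.
Proof. by move=> f; apply: send_ext => v; rewrite /= scaleN1r addNr. Qed.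

HB.instance Definition _ := GRing.isZmodule.Build sEnd
  send_addA send_addC send_add0 send_addN.

Lemma send_scaleA a b f : send_scale a (send_scale b f) = send_scale (a * b) f.
Proof. by apply: send_ext => v; exact: scalerA. Qed.
Lemma send_scale1 : left_id 1 send_scale.
Proof. by move=> f; apply: send_ext => v; exact: scale1r. Qed.
Lemma send_scaleDr : right_distributive send_scale +%R.
Proof. by move=> c f g; apply: send_ext => v; exact: scalerDr. Qed.
Lemma send_scaleDl f : {morph send_scale^~ f : a b / a + b}.
Proof. by move=> a b; apply: send_ext => v; exact: scalerDl. Qed.

HB.instance Definition _ := GRing.Zmodule_isLmodule.Build k sEnd
  send_scaleA send_scale1 send_scaleDr send_scaleDl.

Lemma send_addE f g v : (f + g) v = f v + g v. Proof. by []. Qed.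
Lemma send_scaleE (c : k) f v : (c *: f) v = c *: f v. Proof. by []. Qed.

(* The component of f that maps V_a to V_(a + e); cf. [send_homogP]. *)
Definition send_comp_fun (e : bool) f (v : V) : V :=
  \sum_(a : bool) hcomp (a (+) e) (f (hcomp a v)).

Lemma send_comp_linear e f : linear (send_comp_fun e f).
Proof.
apply: sum_linear => a; apply: comp_linear (hcomp_linear _) _.
exact: comp_linear (send_linear f) (hcomp_linear _).
Qed.

Lemma send_compE e f a v : homog a v -> send_comp_fun e f v = hcomp (a (+) e) (f v).
Proof.
move=> av; rewrite /send_comp_fun (bigD1 a) //= av big1 ?addr0 // => b ba.
by rewrite (homog_neq av ba) (linfun0 (send_linear f)) hcomp0.
Qed.

Lemma hcomp_ract a e v b : homog e b -> hcomp (a (+) e) (rho v b) = rho (hcomp a v) b.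
Proof.
move=> eb; rewrite -{1}[v]hcomp_sum (linfunD (rl b)) hcompD.
have h c : homog (c (+) e) (rho (hcomp c v) b).
  exact: (ract_even rho (homog_hcomp c v) eb).
rewrite !(homogE _ (h _)).
by case: a e {eb h} => [] [] /=; rewrite ?addr0 ?add0r.
Qed.

Lemma send_comp_act e f v b :
  send_comp_fun e f (rho v b) = rho (send_comp_fun e f v) b.
Proof.
have fl := send_comp_linear e f.
rewrite -[b]hcomp_sum -[v]hcomp_sum !(linfunD (rr _), linfunD (rl _), linfunD fl).
have h a c : send_comp_fun e f (rho (hcomp a v) (hcomp c b)) =
             rho (send_comp_fun e f (hcomp a v)) (hcomp c b).
  have hb := homog_hcomp c b; have hv := homog_hcomp a v.
  rewrite (send_compE e f (ract_even rho hv hb)) (send_compE e f hv) send_act.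
  by rewrite addbAC hcomp_ract.
by rewrite !h.
Qed.

Definition send_comp e f : sEnd := SEnd (send_comp_linear e f) (send_comp_act e f).

Lemma send_compP e : linear (send_comp e).
Proof.
move=> c f g; apply: send_hext => a v av.
rewrite send_addE send_scaleE /= !(send_compE _ _ av) send_addE send_scaleE.
exact: hcomp_linear.
Qed.

Lemma send_comp_comp e e' f :
  send_comp e (send_comp e' f) = if e == e' then send_comp e' f else 0.
Proof.
apply: send_hext => a v av; rewrite /= (send_compE _ _ av) /= (send_compE _ _ av).
rewrite hcomp_hcomp (inj_eq (@addbI a)); case: eqP => // _.
by rewrite /= (send_compE _ _ av).
Qed.

Lemma send_comp_sum f : send_comp false f + send_comp true f = f.
Proof.
apply: send_hext => a v av.
rewrite send_addE /= !(send_compE _ _ av) addbF addbT.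
by case: (a); rewrite ?hcomp_sum // addrC hcomp_sum.
Qed.

HB.instance Definition _ := Lmodule_isSuperspace.Build k sEnd
  send_compP send_comp_comp send_comp_sum.

Lemma send_homogP e f :
  homog e f <-> forall a v, homog a v -> homog (a (+) e) (f v).
Proof.
split=> [<- a v av|h].
  by rewrite /= (send_compE _ _ av); exact: homog_hcomp.
by apply: send_hext => a v av; rewrite /= (send_compE _ _ av); exact: h.
Qed.

Program Definition send_mul f g := @SEnd (fun v => f (g v)) _ _.
Next Obligation. exact: comp_linear (send_linear f) (send_linear g). Qed.
Next Obligation. by rewrite !send_act. Qed.

Definition send_one : sEnd := SEnd (@id_linear k V) (fun _ _ => erefl).

Lemma send_mulA : associative send_mul.
Proof. by move=> f g h; apply: send_ext. Qed.
Lemma send_mul1x : left_id send_one send_mul.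
Proof. by move=> f; apply: send_ext. Qed.
Lemma send_mulx1 : right_id send_one send_mul.
Proof. by move=> f; apply: send_ext. Qed.
Lemma send_mul_linearl g : linear (send_mul^~ g).
Proof. by move=> c f f'; apply: send_ext. Qed.
Lemma send_mul_linearr f : linear (send_mul f).
Proof. by move=> c g g'; apply: send_ext => v; exact: send_linear. Qed.
Lemma send_mul_even : even2 send_mul.
Proof.
move=> e e' f g /send_homogP hf /send_homogP hg; apply/send_homogP => a v av.
by rewrite [e (+) e']addbC addbA; apply/hf/hg.
Qed.

HB.instance Definition _ := Superspace_isSuperalgebra.Build k sEnd
  send_mulA send_mul1x send_mulx1 send_mul_linearl send_mul_linearr send_mul_even.

End EndomorphismAlgebra.

Section InvariantAlgebra.
Variables (k : comPzRingType) (d : nat) (B : superalgType k).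

(* The invariants (B^{(x)d})^{S_d}. *)
Record tinv := Tinv {
  tinv_val :> tpow d B;
  _ : [forall g : 'S_d, tact g tinv_val == tinv_val] }.

HB.instance Definition _ := [isSub for tinv_val].
HB.instance Definition _ := [Choice of tinv by <:].

Lemma tinvP (x : tinv) g : tact g x = x.
Proof. by case: x => x /= /forallP /(_ g) /eqP. Qed.

Let mk (x : tpow d B) (h : forall g : 'S_d, tact g x = x) : tinv :=
  Tinv (introT forallP (fun g => introT eqP (h g))).

Fact tinv_add_subproof (x y : tinv) g : tact g (val x + val y) = val x + val y.
Proof. by rewrite (linfunD (tact_linear g)) !tinvP. Qed.
Fact tinv_zero_subproof (g : 'S_d) : tact g (0 : tpow d B) = 0.
Proof. exact: linfun0 (tact_linear g). Qed.
Fact tinv_scale_subproof c (x : tinv) g : tact g (c *: val x) = c *: val x.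
Proof. by rewrite (linfunZ (tact_linear g)) tinvP. Qed.
Fact tinv_comp_subproof e (x : tinv) g : tact g (hcomp e (val x)) = hcomp e (val x).
Proof. by rewrite -hcomp_tact tinvP. Qed.
Fact tinv_mul_subproof (x y : tinv) g : tact g (val x ** val y) = val x ** val y.
Proof. by rewrite tact_smul !tinvP. Qed.
Fact tinv_one_subproof (g : 'S_d) : tact g (sone : tpow d B) = sone.
Proof. exact: tact_sone. Qed.

Definition tinv_add x y := mk (tinv_add_subproof x y).
Definition tinv_zero := mk tinv_zero_subproof.
Definition tinv_scale c x := mk (tinv_scale_subproof c x).
Definition tinv_opp := tinv_scale (-1).
Definition tinv_comp e x := mk (tinv_comp_subproof e x).
Definition tinv_mul x y := mk (tinv_mul_subproof x y).
Definition tinv_one := mk tinv_one_subproof.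

Lemma tinv_addA : associative tinv_add.
Proof. by move=> x y z; apply: val_inj; exact: addrA. Qed.
Lemma tinv_addC : commutative tinv_add.
Proof. by move=> x y; apply: val_inj; exact: addrC. Qed.
Lemma tinv_add0 : left_id tinv_zero tinv_add.
Proof. by move=> x; apply: val_inj; exact: add0r. Qed.
Lemma tinv_addN : left_inverse tinv_zero tinv_opp tinv_add.
Proof. by move=> x; apply: val_inj; rewrite /= scaleN1r addNr. Qed.

HB.instance Definition _ := GRing.isZmodule.Build tinv
  tinv_addA tinv_addC tinv_add0 tinv_addN.

Lemma tinv_scaleA a b x : tinv_scale a (tinv_scale b x) = tinv_scale (a * b) x.
Proof. by apply: val_inj; exact: scalerA. Qed.
Lemma tinv_scale1 : left_id 1 tinv_scale.
Proof. by move=> x; apply: val_inj; exact: scale1r. Qed.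
Lemma tinv_scaleDr : right_distributive tinv_scale +%R.
Proof. by move=> c x y; apply: val_inj; exact: scalerDr. Qed.
Lemma tinv_scaleDl x : {morph tinv_scale^~ x : a b / a + b}.
Proof. by move=> a b; apply: val_inj; exact: scalerDl. Qed.

HB.instance Definition _ := GRing.Zmodule_isLmodule.Build k tinv
  tinv_scaleA tinv_scale1 tinv_scaleDr tinv_scaleDl.

Lemma tinv_comp_linear e : linear (tinv_comp e).
Proof. by move=> c x y; apply: val_inj; exact: hcomp_linear. Qed.
Lemma tinv_comp_comp e f x : tinv_comp e (tinv_comp f x) = if e == f then tinv_comp f x else 0.
Proof. by apply: val_inj; rewrite /= hcomp_hcomp; case: eqP. Qed.
Lemma tinv_comp_sum x : tinv_comp false x + tinv_comp true x = x.
Proof. by apply: val_inj; exact: hcomp_sum. Qed.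

HB.instance Definition _ := Lmodule_isSuperspace.Build k tinv
  tinv_comp_linear tinv_comp_comp tinv_comp_sum.

Lemma tinv_mulA : associative tinv_mul.
Proof. by move=> x y z; apply: val_inj; exact: smulA. Qed.
Lemma tinv_mul1x : left_id tinv_one tinv_mul.
Proof. by move=> x; apply: val_inj; exact: smul1x. Qed.
Lemma tinv_mulx1 : right_id tinv_one tinv_mul.
Proof. by move=> x; apply: val_inj; exact: smulx1. Qed.
Lemma tinv_mul_linearl y : linear (tinv_mul^~ y).
Proof. by move=> c x x'; apply: val_inj; exact: smul_linearl. Qed.
Lemma tinv_mul_linearr x : linear (tinv_mul x).
Proof. by move=> c y y'; apply: val_inj; exact: smul_linearr. Qed.
Lemma tinv_mul_even : even2 tinv_mul.
Proof.
move=> e f x y hx hy; apply: val_inj; apply: homog_smul.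
  exact: (congr1 val hx).
exact: (congr1 val hy).
Qed.

HB.instance Definition _ := Superspace_isSuperalgebra.Build k tinv
  tinv_mulA tinv_mul1x tinv_mulx1 tinv_mul_linearl tinv_mul_linearr tinv_mul_even.

End InvariantAlgebra.

Section SchurAlgebra.
Variables (k : comPzRingType) (A : superalgType k) (n d : nat).

Definition schur := tinv d (mxk A n n).
HB.instance Definition _ := Superalgebra.on schur.

(* The left action of M_n(A)^{(x)d} on V^{(x)d}. *)
Definition tmx_act : tpow d (mxk A n n) -> tpow d (mxk A n 1) -> tpow d (mxk A n 1) :=
  tprod (@mxk_mul k A n n 1).

End SchurAlgebra.

(* Main.v *)
Require Import Defs.
From mathcomp Require Import all_boot all_algebra.
From mathcomp Require Import all_fingroup.

(** Why the theorem holds. Write [e_C] for the pure tensor of standard column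
    vectors indexed by C, that is [tunit C sone]. The matrix units cut
    every tensor power of a matrix space into copies of A^{(x)d}: each tensor is
    recovered from its entries, which are tensors in A^{(x)d} ([tentry_tunit],
    [sum_tunit]). In particular the [e_C] generate V^{(x)d} as a right
    A^{(x)d}-module ([tunit_act]). They are even, so the sign rule is silent on
    them, and the entry (I, C) of a matrix tensor xi is the coordinate I of
    xi e_C ([tentry_act]), as for ordinary matrices.

    This makes xi |-> (v |-> xi v) injective, since the entries of xi can be read
    off its action, and surjective onto the A^{(x)d}-linear maps, since such a map
    f is determined by the f e_C, hence equals the action of the tensor
    [mx_of_end f] whose entries are the coordinates of the f e_C.

    The action map commutes with permutations, (xi v)^g = xi^g v^g, and W_d^A is
    generated by A^{(x)d} and S_d. Hence an invariant xi acts W_d^A-linearly;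
    conversely, if xi acts W_d^A-linearly then xi^g acts as xi does, so that
    xi^g = xi by injectivity. The isomorphism thus restricts to the invariants on
    one side and to the W_d^A-linear maps on the other. *)

Set Implicit Arguments.
Unset Strict Implicit.
Unset Printing Implicit Defensive.

Import GRing.Theory.
Local Open Scope ring_scope.

(** * Generators of tensor powers *)

(** Induction over the tensors of elements of a set X that spans V additively:
    the factors are decomposed one at a time. *)
Lemma tpow_gen_span (k : comPzRingType) (d : nat) (V : lmodType k)
    (X : V -> Prop) (P : tpow d V -> Prop) :
  (forall v, exists (J : finType) (w : J -> V), (forall j, X (w j)) /\ v = \sum_j w j) ->
  P 0 -> (forall x y, P x -> P y -> P (x + y)) -> (forall c x, P x -> P (c *: x)) ->
  (forall u : {ffun 'I_d -> V}, (forall i, X (u i)) -> P (tens u)) -> forall x, P x.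
Proof.
move=> gen P0 PD PZ Pt; apply: tpow_span => // u.
(* The factors from m on are known to lie in X. *)
suff h m : forall u : {ffun 'I_d -> V},
    (forall i : 'I_d, (m <= i)%N -> X (u i)) -> P (tens u).
  by apply: (h d) => i; rewrite leqNgt ltn_ord.
elim: m => [|m IHm] {}u hu; first by apply: Pt => i; exact: hu.
have [md|dm] := ltnP m d; last first.
  apply: IHm => i mi; have := ltn_ord i.
  by rewrite ltnNge (leq_trans dm mi).
pose i0 := Ordinal md; have [J [w [wX uw]]] := gen (u i0).
have -> : u = tset u i0 (\sum_j w j).
  by apply/ffunP => i; rewrite ffunE -uw; case: eqP => // ->.
rewrite (linfun_sum (tens_multilinear u i0)).
elim/big_rec: _ => // j x _ Px; apply: PD => //; apply: IHm => i mi; rewrite ffunE.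
case: eqVneq => [_|ne]; first exact: wX.
apply: hu; rewrite ltn_neqAle mi andbT.
by apply: contraNneq ne => e; apply/eqP/val_inj.
Qed.

(** * Entries of tensors of matrices *)

Section Entries.
Variables (k : comPzRingType) (A : superalgType k) (d m p : nat).
Implicit Types (ij : 'I_m * 'I_p) (J : {ffun 'I_d -> 'I_m * 'I_p}).

Definition mxk_unit ij (a : A) : mxk A m p :=
  \matrix_(i, j) (if (i, j) == ij then a else 0).

Definition mxk_entry ij (M : mxk A m p) : A := M ij.1 ij.2.

Lemma mxk_entry_linear ij : linear (mxk_entry ij).
Proof. by move=> c M N; rewrite /mxk_entry !mxE. Qed.

Lemma mxk_unit_linear ij : linear (mxk_unit ij).
Proof.
move=> c a b; apply/matrixP => i j; rewrite !mxE.
by case: eqP => // _; rewrite scaler0 addr0.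
Qed.

Lemma homog_mxk_unit e ij a : homog e a -> homog e (mxk_unit ij a).
Proof.
move=> ha; apply/mxk_homogP => i j; rewrite mxE.
by case: eqP => // _; exact: homog0.
Qed.

Lemma mxk_entry_unit ij ij' a :
  mxk_entry ij (mxk_unit ij' a) = if ij == ij' then a else 0.
Proof. by rewrite /mxk_entry mxE -surjective_pairing. Qed.

Lemma mxk_sum_unit (M : mxk A m p) : M = \sum_ij mxk_unit ij (mxk_entry ij M).
Proof.
apply/matrixP => i j; rewrite summxE (bigD1 (i, j)) //= mxE eqxx.
by rewrite big1 ?addr0 // => ij ne; rewrite mxE eq_sym (negPf ne).
Qed.

Definition tentry J : tpow d (mxk A m p) -> tpow d A :=
  tlift (fun u => tens [ffun i => mxk_entry (J i) (u i)]).

Definition tunit J : tpow d A -> tpow d (mxk A m p) :=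
  tlift (fun a => tens [ffun i => mxk_unit (J i) (a i)]).

Lemma tentry_multilinear J :
  multilinear (fun u : {ffun 'I_d -> mxk A m p} => tens [ffun i => mxk_entry (J i) (u i)]).
Proof.
apply: (multilinear_comp (g := fun i => mxk_entry (J i))) => [|i].
  exact: tens_multilinear.
exact: mxk_entry_linear.
Qed.

Lemma tunit_multilinear J :
  multilinear (fun a : {ffun 'I_d -> A} => tens [ffun i => mxk_unit (J i) (a i)]).
Proof.
apply: (multilinear_comp (g := fun i => mxk_unit (J i))) => [|i].
  exact: tens_multilinear.
exact: mxk_unit_linear.
Qed.

Lemma tentry_linear J : linear (tentry J).
Proof. exact/tlift_linear/tentry_multilinear. Qed.

Lemma tunit_linear J : linear (tunit J).
Proof. exact/tlift_linear/tunit_multilinear. Qed.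

Lemma tentry_tens J u : tentry J (tens u) = tens [ffun i => mxk_entry (J i) (u i)].
Proof. exact/tlift_tens/tentry_multilinear. Qed.

Lemma tunit_tens J a : tunit J (tens a) = tens [ffun i => mxk_unit (J i) (a i)].
Proof. exact/tlift_tens/tunit_multilinear. Qed.

(** Distinct J and J' differ at some factor i, where the entry is zero. *)
Lemma tentry_tunit J J' x : tentry J (tunit J' x) = if J == J' then x else 0.
Proof.
move: x; apply: tlift_uniq.
- exact: comp_linear (tentry_linear J) (tunit_linear J').
- by case: eqP => _; [exact: id_linear|exact: zero_linear].
move=> a; rewrite tunit_tens tentry_tens; case: eqVneq => [->|ne].
  by congr tens; apply/ffunP => i; rewrite !ffunE mxk_entry_unit eqxx.
have /existsP [i Ji] : [exists i, J i != J' i].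
  apply: contraNT ne => /existsPn h; apply/eqP/ffunP => i.
  by apply/eqP; move: (h i); rewrite negbK.
apply: (multilinear0 (i := i) (@tens_multilinear k d A)).
by rewrite !ffunE mxk_entry_unit (negPf Ji).
Qed.

(** On a tensor of matrix units only one term survives, and such tensors span. *)
Lemma sum_tunit x : \sum_J tunit J (tentry J x) = x.
Proof.
have sl : linear (fun x => \sum_J tunit J (tentry J x)).
  by apply: sum_linear => J; exact: comp_linear (tunit_linear J) (tentry_linear J).
move: x; apply: (tpow_gen_span (X := fun M => exists ija, M = mxk_unit ija.1 ija.2)).
- move=> M; exists ('I_m * 'I_p)%type, (fun ij => mxk_unit ij (mxk_entry ij M)).
  by split; [move=> ij; exists (ij, mxk_entry ij M)|exact: mxk_sum_unit].
- exact: (linfun0 sl).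
- by move=> x y hx hy; rewrite (linfunD sl) hx hy.
- by move=> c x hx; rewrite (linfunZ sl) hx.
move=> u /fin_all_exists [f uf].
have -> : tens u = tunit [ffun i => (f i).1] (tens [ffun i => (f i).2]).
  by rewrite tunit_tens; congr tens; apply/ffunP => i; rewrite !ffunE.
rewrite (bigD1 [ffun i => (f i).1]) //= tentry_tunit eqxx big1 ?addr0 // => J ne.
by rewrite tentry_tunit (negPf ne) (linfun0 (tunit_linear J)).
Qed.

Lemma tentry_inj x y : (forall J, tentry J x = tentry J y) -> x = y.
Proof.
by move=> h; rewrite -[x]sum_tunit -[y]sum_tunit; apply: eq_bigr => J _; rewrite h.
Qed.

Lemma tunit_sone J : tunit J sone = tens [ffun i => mxk_unit (J i) sone].
Proof.
rewrite [LHS]tunit_tens; congr tens.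
by apply/ffunP => i; rewrite !ffunE.
Qed.

Lemma homogt_unit J :
  homogt [ffun=> false] [ffun i => mxk_unit (J i) (sone : A)].
Proof. by move=> i; rewrite !ffunE; apply/homog_mxk_unit/homog_sone. Qed.

End Entries.

(** * Matrix tensors acting on tensors of columns *)

Section Columns.
Variables (k : comPzRingType) (A : superalgType k) (d n : nat).

Notation V := (mxk A n 1).
Notation T := (tpow d (mxk A n n)).
Notation cix := {ffun 'I_d -> 'I_n * 'I_1}.

Implicit Types (I C : cix) (xi : T) (v : tpow d V) (g : 'S_d).

Lemma colact_unit (ij : 'I_n * 'I_1) (a : A) :
  colact (mxk_unit ij sone) a = mxk_unit ij a.
Proof.
apply/matrixP => i j; rewrite !mxE.
by case: eqP => _; [exact: smul1x|exact: linfun0 (smul_linearl a)].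
Qed.

(** The e_C generate V^{(x)d} over A^{(x)d}; no sign arises because [sone], hence
    e_C, is even in every factor. *)
Lemma tunit_act C a : tunit C a = tpow_act (col_mod A n) (tunit C sone) a.
Proof.
move: a; apply: tpow_huniq => [||p a pa].
- exact: tunit_linear.
- exact: (proj2 (tpow_act_bilin d (col_mod A n)) _).
rewrite tunit_sone tunit_tens /tpow_act.
rewrite (tprodE (ract_bilin (col_mod A n)) (homogt_unit A C) pa) brk0l scale1r.
by congr tens; apply/ffunP => i; rewrite !ffunE /= colact_unit.
Qed.

Lemma mxk_entry_mul (ij c : 'I_n * 'I_1) (M : mxk A n n) :
  mxk_entry ij (mxk_mul M (mxk_unit c sone)) = mxk_entry (ij.1, c.1) M.
Proof.
case: c => c0 c1; rewrite /mxk_entry mxE (bigD1 c0) //= mxE (ord1 ij.2) (ord1 c1) eqxx.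
rewrite big1 => [|l ne]; first by rewrite addr0; exact: (@smulx1 k A).
by rewrite mxE xpair_eqE (negPf ne) mulr0.
Qed.

Definition mx_ix I C : {ffun 'I_d -> 'I_n * 'I_n} := [ffun i => ((I i).1, (C i).1)].

(** Column C of xi is its value at e_C, as for ordinary matrices, again because
    e_C is even. *)
Lemma tentry_act I C xi :
  tentry I (tmx_act xi (tunit C sone)) = tentry (mx_ix I C) xi.
Proof.
have mb := @mxk_mul_bilin k A n n 1.
move: xi; apply: tpow_huniq => [||p u pu].
- exact: comp_linear (tentry_linear I) (tprod_linearl mb _).
- exact: tentry_linear.
rewrite tunit_sone /tmx_act (tprodE mb pu (homogt_unit A C)) brk0r scale1r !tentry_tens.
by congr tens; apply/ffunP => i; rewrite !ffunE mxk_entry_mul.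
Qed.

Lemma tmx_act_inj xi eta : (forall v, tmx_act xi v = tmx_act eta v) -> xi = eta.
Proof.
move=> h; apply: tentry_inj => J.
have -> : J = mx_ix [ffun i => ((J i).1, ord0)] [ffun i => ((J i).2, ord0)].
  by apply/ffunP => i; rewrite !ffunE -surjective_pairing.
by rewrite -!tentry_act h.
Qed.

Lemma tmx_act_linear xi : linear (tmx_act xi).
Proof. exact: tprod_linearr (@mxk_mul_bilin k A n n 1) xi. Qed.

Lemma tmx_act_tpow_act xi v a :
  tmx_act xi (tpow_act (col_mod A n) v a) = tpow_act (col_mod A n) (tmx_act xi v) a.
Proof.
have mb := @mxk_mul_bilin k A n n 1; have cb := @colact_bilin k A n.
apply/esym; apply: (tprodA mb cb cb mb).
- exact: mxk_mul_even.
- exact: colact_even.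
move=> M u b; apply/matrixP => i j; rewrite !mxE (linfun_sum (smul_linearl b)).
by apply: eq_bigr => l _; rewrite !mxE; exact/esym/smulA.
Qed.

Lemma tmx_actM xi eta v : tmx_act (xi ** eta) v = tmx_act xi (tmx_act eta v).
Proof.
have mb := @mxk_mul_bilin k A n n.
apply: (tprodA (mb n) (mb 1%N) (mb 1%N) (mb 1%N)).
- exact: mxk_mul_even.
- exact: mxk_mul_even.
by move=> M N u; exact/esym/mulmxA.
Qed.

Lemma tmx_act1 v : tmx_act sone v = v.
Proof. by apply: tprod1l => [|u]; [exact: mxk_mul_bilin|exact: mul1mx]. Qed.

Lemma tact_tmx_act g xi v : tact g (tmx_act xi v) = tmx_act (tact g xi) (tact g v).
Proof. by apply: tact_tprod; [exact: mxk_mul_bilin|exact: mxk_mul_even]. Qed.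

(** For invariant xi, (xi v)^g = xi^g v^g = xi v^g. *)
Lemma tmx_act_wreath_act xi v w : (forall g, tact g xi = xi) ->
  tmx_act xi (wreath_act (col_mod A n) v w) = wreath_act (col_mod A n) (tmx_act xi v) w.
Proof.
move=> inv; rewrite (linfun_sum (tmx_act_linear xi)); apply: eq_bigr => g _.
by rewrite -{1}(inv g) -tact_tmx_act tmx_act_tpow_act.
Qed.

Definition end_of_mx xi : sEnd (tpow_mod d (col_mod A n)) :=
  SEnd (rho := tpow_mod d (col_mod A n)) (tmx_act_linear xi) (tmx_act_tpow_act xi).

Definition mx_of_end (f : sEnd (tpow_mod d (col_mod A n))) : T :=
  \sum_(J : {ffun 'I_d -> 'I_n * 'I_n})
     tunit J (tentry [ffun i => ((J i).1, ord0)]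
                     (f (tunit [ffun i => ((J i).2, ord0)] sone))).

Lemma tentry_mx_of_end f I C :
  tentry (mx_ix I C) (mx_of_end f) = tentry I (f (tunit C sone)).
Proof.
rewrite /mx_of_end (linfun_sum (tentry_linear _)) (bigD1 (mx_ix I C)) //=.
rewrite tentry_tunit eqxx big1 ?addr0 => [|J ne]; last first.
  by rewrite tentry_tunit eq_sym (negPf ne).
(* The second component of a column index, in 'I_1, carries no information. *)
have E (K : cix) (h : 'I_d -> 'I_n) : (forall i, h i = (K i).1) ->
    [ffun i => (h i, ord0)] = K.
  by move=> hK; apply/ffunP => i; rewrite ffunE hK; case: (K i) => j z; rewrite (ord1 z).
by congr (tentry _ (f (tunit _ _))); apply: E => i; rewrite ffunE.
Qed.

(** Both sides are A^{(x)d}-linear, so they are compared on the generators e_C,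
    entry by entry. *)
Lemma end_of_mxK f : end_of_mx (mx_of_end f) = f.
Proof.
apply: send_ext => v; rewrite -[v]sum_tunit.
rewrite (linfun_sum (send_linear (end_of_mx (mx_of_end f)))) (linfun_sum (send_linear f)).
apply: eq_bigr => C _; rewrite tunit_act.
rewrite !(send_act (rho := tpow_mod d (col_mod A n))).
congr tpow_act; apply: tentry_inj => I.
by rewrite [LHS]tentry_act tentry_mx_of_end.
Qed.

Lemma end_of_mx_inj : injective end_of_mx.
Proof.
by move=> xi eta h; apply: tmx_act_inj => v; exact: (congr1 (fun f => send_fun f v) h).
Qed.

(** Stated over any algebra B, so as to serve for both A^{(x)d} and W_d^A. *)
Lemma homog_end_tmx_act (B : superalgType k) (rho : rsupermod B (tpow d V))
    (f : sEnd rho) e xi :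
  (forall v, f v = tmx_act xi v) -> homog e xi -> homog e f.
Proof.
move=> fE hxi; apply/send_homogP => a v av; rewrite fE addbC.
apply: (tprod_even _ _ hxi av); [exact: mxk_mul_bilin|exact: mxk_mul_even].
Qed.

Lemma end_of_mx_iso : superalg_iso end_of_mx.
Proof.
split.
- move=> c xi eta; apply: send_ext => v.
  exact: tprod_linearl (@mxk_mul_bilin k A n n 1) v c xi eta.
- by move=> xi eta; apply: send_ext => v; exact: tmx_actM.
- by apply: send_ext => v; exact: tmx_act1.
- by move=> e xi; exact: homog_end_tmx_act.
exists mx_of_end; last exact: end_of_mxK.
exact: inj_can_sym end_of_mxK end_of_mx_inj.
Qed.

(** * The invariants and the wreath product *)

Notation rhoW := (wreath_mod d (col_mod A n)).

Definition wend_of_schur (x : schur A n d) : sEnd rhoW :=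
  SEnd (rho := rhoW) (tmx_act_linear (tinv_val x))
    (fun v w => tmx_act_wreath_act v w (@tinvP _ _ _ x)).

Lemma wend_act (f : sEnd rhoW) v a :
  f (tpow_act (col_mod A n) v a) = tpow_act (col_mod A n) (f v) a.
Proof.
have := send_act f v (wmono a 1%g).
by rewrite /= !wreath_actE !tact1.
Qed.

Lemma wend_tact (f : sEnd rhoW) g v : f (tact g v) = tact g (f v).
Proof.
have := send_act f v (wmono sone g).
by rewrite /= !wreath_actE !tpow_act1.
Qed.

Definition wend_res (f : sEnd rhoW) : sEnd (tpow_mod d (col_mod A n)) :=
  SEnd (rho := tpow_mod d (col_mod A n)) (send_linear f) (wend_act f).

Lemma tmx_act_wend f v : tmx_act (mx_of_end (wend_res f)) v = f v.
Proof. exact: (congr1 (fun h => send_fun h v) (end_of_mxK (wend_res f))). Qed.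

(** The action is faithful, and xi^g acts as v |-> (xi v^(g^-1))^g, which is the
    action of xi when that action commutes with g. *)
Lemma tact_mx_of_wend f g :
  tact g (mx_of_end (wend_res f)) = mx_of_end (wend_res f).
Proof.
apply: tmx_act_inj => v.
have -> : v = tact g (tact g^-1%g v) by rewrite tactM mulgV tact1.
by rewrite -tact_tmx_act !tmx_act_wend (wend_tact f g).
Qed.

Definition schur_of_wend (f : sEnd rhoW) : schur A n d :=
  Tinv (introT forallP (fun g => introT eqP (tact_mx_of_wend f g))).

Lemma wend_of_schur_iso : superalg_iso wend_of_schur.
Proof.
split.
- move=> c x y; apply: send_ext => v.
  exact: tprod_linearl (@mxk_mul_bilin k A n n 1) v c (tinv_val x) (tinv_val y).
- by move=> x y; apply: send_ext => v; exact: tmx_actM.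
- by apply: send_ext => v; exact: tmx_act1.
- move=> e x hx; apply: (@homog_end_tmx_act _ _ _ _ (tinv_val x)) => //.
  exact: (congr1 val hx).
have K : cancel schur_of_wend wend_of_schur.
  by move=> f; apply: send_ext => v; exact: tmx_act_wend.
exists schur_of_wend => //; apply: inj_can_sym K _ => x y h.
by apply: val_inj; apply: tmx_act_inj => v; exact: (congr1 (fun f => send_fun f v) h).
Qed.

End Columns.

Theorem lemma5p7 (k : comPzRingType) (A : superalgType k)
    (I : finType) (b : I -> A) (hb : homog_basis b)
    (d n : nat) (hn : (0 < n)%N) :
  exists (F : tpow d (mxk A n n) -> sEnd (tpow_mod d (col_mod A n)))
         (G : schur A n d -> sEnd (wreath_mod d (col_mod A n))),
    [/\ (forall xi v, F xi v = tmx_act xi v),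
        superalg_iso F,
        (forall xi v, G xi v = F (tinv_val xi) v)
      & superalg_iso G].
Proof.
exists (@end_of_mx k A d n), (@wend_of_schur k A d n); split=> //.
- exact: end_of_mx_iso.
- exact: wend_of_schur_iso.
Qed.
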